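(* Let $X$ be a real Banach space and let $T:X\rightrightarrows X^*$ be maximal monotone. Then all the conditions 1–9 below are equivalent, and they hold if and only if $T$ is of Gossez type (D): 1. $T$ is of type (NI). 2. $(\mathcal{S}_T)^*(x^*,x^{**})\geq\langle x^*,x^{**}\rangle$ for all $(x^*,x^{**})\in X^*\times X^{**}$. 3. For all $h\in\mathcal{F}_T$, $h^{*}(x^*,x^{**})\geq\langle x^*,x^{**}\rangle$ for all $(x^*,x^{**})\in X^*\times X^{**}$. 4. There exists $h\in\mathcal{F}_T$ such that $h^{*}(x^*,x^{**})\geq\langle x^*,x^{**}\rangle$ for all $(x^*,x^{**})\in X^*\times X^{**}$. 5. There exists $h\in\mathcal{F}_T$ such that $$\inf_{(x,x^* )\in X\times X^*} h_{(x_0,x_0^* )}(x,x^* )+\tfrac12\|x\|^2+\tfrac12\|x^*\|^2=0\quad\text{for all }(x_0,x_0^* )\in X\times X^*.$$ 6. For all $h\in\mathcal{F}_T$, $$\inf_{(x,x^* )\in X\times X^*} h_{(x_0,x_0^* )}(x,x^* )+\tfrac12\|x\|^2+\tfrac12\|x^*\|^2=0\quad\text{for all }(x_0,x_0^* )\in X\times X^*.$$ 7. $\overline{R(T(\cdot+z_0)+J)}=X^*$ for all $z_0\in X$. 8. $\overline{R(T(\cdot+z_0)+J_\varepsilon)}=X^*$ for all $\varepsilon>0$ and $z_0\in X$. 9. $R(T(\cdot+z_0)+J_\varepsilon)=X^*$ for all $\varepsilon>0$ and $z_0\in X$. Moreover, if any of these conditions holds, then: (a) $T$ satisfies the strict Brøndsted–Rockafellar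 property; (b) $T$ has a unique maximal monotone extension to an operator from $X^{**}$ into $X^*$, and this extension is $\overline{T}^{\,g}:X^{**}\rightrightarrows X^*$; (c) $(\mathcal{S}_T)^*=\varphi_{\Lambda\overline{T}^{\,g}}$; (d) for any $h\in\mathcal{F}_T$, $h^*\in\mathcal{F}_{\Lambda\overline{T}^{\,g}}$.
   Context: $X$ is a real Banach space with dual $X^*$ and bidual $X^{**}$; $X$ is identified with its canonical image in $X^{**}$. $\overline{\mathbb{R}}=[-\infty,\infty]$. Duality products: $\langle x,x^*\rangle=x^*(x)$ on $X\times X^*$ and $\langle x^*,x^{**}\rangle=x^{**}(x^* )$ on $X^*\times X^{**}$; the order of the arguments is immaterial. Operators. A point-to-set operator $T:X\rightrightarrows X^*$ (resp. $T:X^{**}\rightrightarrows X^*$) is a subset of $X\times X^*$ (resp. $X^{**}\times X^*$), and $r\in T(q)$ means $(q,r)\in T$. It is monotone if $\langle q-q',r-r'\rangle\ge0$ for all $(q,r),(q',r')\in T$, and maximal monotone if it is monotone and maximal under inclusion among monotone subsets of $X\times X^*$ (resp. of $X^{**}\times X^*$). A maximal monotone extension of $T:X\rightrightarrows X^*$ to an operator from $X^{**}$ into $X^*$ is a maximal monotone operator in $X^{**}\times X^*$ containing $T$. $R(T)$ is the range of $T$, $T(\cdot+z_0)$ is the operator $x\mapsto T(x+z_0)$, sums of operators are pointwise Minkowski sums, and $\overline{A}$ is the closure of $A\subset X^*$ in the strong (norm) topology. Gossez's monotone closure of a maximal monotone $T:X\rightrightarrows X^*$ is $$\overline{T}^{\,g}=\{(x^{**},x^*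 )\in X^{**}\times X^*:\ \langle x^*-y^*,x^{**}-y\rangle\ge0\ \ \forall (y,y^* )\in T\}.$$ $T$ is of Gossez type (D) if for every $(x^{**},x^* )\in\overline{T}^{\,g}$ there is a bounded net $\{(x_i,x_i^* )\}_{i\in I}$ in $T$ converging to $(x^{**},x^* )$ in the $\sigma(X^{**},X^* )\times$strong topology of $X^{**}\times X^*$. $T$ is of (Simons) type (NI) if $\inf_{(y,y^* )\in T}\langle y^*-x^*,y-x^{**}\rangle\le0$ for all $(x^*,x^{**})\in X^*\times X^{**}$. $T$ satisfies the strict Brøndsted–Rockafellar property if for any $\varepsilon>0$ and every $(x,x^* )\in X\times X^*$ with $\inf_{(y,y^* )\in T}\langle x-y,x^*-y^*\rangle>-\varepsilon$, it holds that for any $\lambda>0$ there is $(x_\lambda,x_\lambda^* )\in T$ with $\|x-x_\lambda\|<\lambda$ and $\|x^*-x_\lambda^*\|<\varepsilon/\lambda$. Fitzpatrick functions. For $T:X\rightrightarrows X^*$, $\mathcal{F}_T$ is the set of functions $h:X\times X^*\to\overline{\mathbb{R}}$ that are convex, lower semicontinuous (strong topology), satisfy $h(x,x^* )\ge\langle x,x^*\rangle$ for all $(x,x^* )\in X\times X^*$, and $h(x,x^* )=\langle x,x^*\rangle$ for all $(x,x^* )\in T$. The $\mathcal{S}$-function is $\mathcal{S}_T=\sup_{h\in\mathcal{F}_T}h$ (pointwise supremum), the largest element of $\mathcal{F}_T$. The Fitzpatrick function is $\varphi_T(x,x^* )=\sup_{(y,y^* )\in T}\langle y,x^*\rangle+\langle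 y^*,x\rangle-\langle y,y^*\rangle$. The map $\Lambda:X^{**}\times X^*\to X^*\times X^{**}$ is $\Lambda(x^{**},x^* )=(x^*,x^{**})$; for $S\subset X^{**}\times X^*$, $\Lambda S\subset X^*\times X^{**}$ is viewed as an operator $X^*\rightrightarrows X^{**}$, and $\mathcal{F}_{\Lambda S}$ and $\varphi_{\Lambda S}$ are defined by the same formulas with $X^*\times X^{**}$ in place of $X\times X^*$ (so they consist of, resp. are, functions on $X^*\times X^{**}$). Conjugation. For $h:X\times X^*\to\overline{\mathbb{R}}$, using $(X\times X^* )^*=X^*\times X^{**}$, the Fenchel–Legendre conjugate is $h^*(x^*,x^{**})=\sup_{(y,y^* )\in X\times X^*}\langle y,x^*\rangle+\langle y^*,x^{**}\rangle-h(y,y^* )$. For $h:X\times X^*\to\overline{\mathbb{R}}$ and $(z,z^* )\in X\times X^*$, $h_{(z,z^* )}(x,x^* )=h(x+z,x^*+z^* )-[\langle x,z^*\rangle+\langle z,x^*\rangle+\langle z,z^*\rangle]$. For $f:X\to\overline{\mathbb{R}}$ and $\varepsilon\ge0$, $\partial_\varepsilon f(x)=\{x^*\in X^*: f(y)\ge f(x)+\langle y-x,x^*\rangle-\varepsilon\ \forall y\in X\}$ and $\partial f=\partial_0 f$. $J(x)=\partial\,\tfrac12\|\cdot\|^2(x)$ is the duality mapping and $J_\varepsilon(x)=\partial_\varepsilon\,\tfrac12\|\cdot\|^2(x)$. *)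

(* Defs.v *)
From HB Require Import structures.
From mathcomp Require Import all_boot all_order all_algebra.
From mathcomp Require Import all_classical all_reals all_analysis.
Set Implicit Arguments.
Unset Strict Implicit.
Unset Printing Implicit Defensive.
Import Order.TTheory GRing.Theory Num.Theory.
Import numFieldNormedType.Exports.
Local Open Scope classical_set_scope.
Local Open Scope ring_scope.

Section dual_space.
Context {R : realType} (E : normedModType R).

Definition continuous_linear : {pred E -> R^o} :=
  fun f => `[< linear f /\ continuous f >].

Lemma continuous_linear_submod : submod_closed continuous_linear.
Proof.
split=> [|a f g /asboolP[lf cf] /asboolP[lg cg]]; apply/asboolP; split.
- by move=> b x y /=; rewrite scaler0 addr0.
- exact: cst_continuous.
- move=> b x y; rewrite !fctE lf lg !scalerDr addrACA; congr (_ + _ + _).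
  by rewrite !scalerA mulrC.
- by move=> x; apply: cvgD; [apply: cvgZl_tmp; exact: cf|exact: cg].
Qed.

HB.instance Definition _ :=
  GRing.isSubmodClosed.Build R (E -> R^o) continuous_linear
    continuous_linear_submod.

Record dual_space := DualSpace {
  dual_fun :> E -> R^o ;
  dual_funP : dual_fun \in continuous_linear }.

HB.instance Definition _ := [isSub for dual_fun].
HB.instance Definition _ := [Choice of dual_space by <:].
HB.instance Definition _ := [SubChoice_isSubLmodule of dual_space by <:].

Implicit Types f g : dual_space.

Lemma dual_linear f : linear f.
Proof. by have /asboolP[] := dual_funP f. Qed.

HB.instance Definition _ f :=
  GRing.isLinear.Build R E R^o _ (dual_fun f) (@dual_linear f).

Lemma dual_continuous f : continuous f.
Proof. by have /asboolP[] := dual_funP f. Qed.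

Definition dual_norm f : R := sup [set `|f x| | x in [set x | `|x| <= 1]].

Lemma dual_norm_has_sup f : has_sup [set `|f x| | x in [set x | `|x| <= 1]].
Proof.
split; first by exists `|f 0|, 0 => //=; rewrite normr0 ler01.
have /linear_bounded_continuous/bounded_funP/(_ 1)[M fM] := @dual_continuous f.
by exists M => _ [x /= /fM ? <-].
Qed.

Lemma dual_norm_ge0 f : 0 <= dual_norm f.
Proof.
apply: le_trans (normr_ge0 (f 0)) _.
apply: ub_le_sup; first exact: (dual_norm_has_sup f).2.
by exists 0 => //=; rewrite normr0 ler01.
Qed.

Lemma le_dual_norm f x : `|f x| <= dual_norm f * `|x|.
Proof.
have [->|x0] := eqVneq x 0; first by rewrite linear0 !normr0 mulr0.
rewrite -ler_pdivrMr ?normr_gt0//.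
apply: ub_le_sup; first exact: (dual_norm_has_sup f).2.
exists (`|x|^-1 *: x) => /=.
  by rewrite normrZ normfV normr_id mulVf ?normr_eq0.
by rewrite linearZ/= normrZ normfV normr_id mulrC.
Qed.

Lemma dual_norm_le f c : 0 <= c ->
  (forall x, `|f x| <= c * `|x|) -> dual_norm f <= c.
Proof.
move=> c0 fc; apply: ge_sup; first exact: (dual_norm_has_sup f).1.
by move=> _ [x /= x1 <-]; rewrite (le_trans (fc x))// ler_piMr.
Qed.

Lemma dual_normD f g : dual_norm (f + g) <= dual_norm f + dual_norm g.
Proof.
apply: dual_norm_le => [|x]; first by rewrite addr_ge0 ?dual_norm_ge0.
by rewrite mulrDl (le_trans (ler_normD _ _))// lerD ?le_dual_norm.
Qed.

Lemma dual_normZ (a : R) f : dual_norm (a *: f) = `|a| * dual_norm f.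
Proof.
apply/eqP; rewrite eq_le; apply/andP; split.
  apply: dual_norm_le => [|x]; first by rewrite mulr_ge0 ?dual_norm_ge0.
  by rewrite normrZ -mulrA ler_wpM2l ?le_dual_norm.
have [->|a0] := eqVneq a 0; first by rewrite normr0 mul0r dual_norm_ge0.
rewrite mulrC -ler_pdivlMr ?normr_gt0//.
apply: dual_norm_le => [|x]; first by rewrite divr_ge0 ?dual_norm_ge0.
rewrite mulrAC ler_pdivlMr ?normr_gt0// mulrC -normrZ.
exact: (le_dual_norm (a *: f)).
Qed.

Lemma dual_norm0_eq0 f : dual_norm f = 0 -> f = 0.
Proof.
move=> f0; apply/val_inj/funext => x /=; apply/eqP.
by rewrite -normr_le0 -[leRHS](mul0r `|x|) -f0 le_dual_norm.
Qed.

HB.instance Definition _ :=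
  Lmodule_isNormed.Build R dual_space dual_normD dual_normZ dual_norm0_eq0.

End dual_space.

Section bidual.
Context {R : realType} (E : normedModType R).
Implicit Types (x : E) (f : dual_space E).

Lemma evaluation_continuous_linear x :
  (fun f => f x : R^o) \in @continuous_linear R (dual_space E).
Proof.
apply/asboolP.
have lev : linear (fun f => f x : R^o) by [].
split=> //.
pose ev : {linear dual_space E -> R^o} :=
  HB.pack (fun f => f x : R^o) (GRing.isLinear.Build R _ R^o _ _ lev).
apply: (@bounded_linear_continuous _ _ _ ev); apply/bounded_funP => r.
exists (r * `|x|) => f fr; apply: (le_trans (le_dual_norm f x)).
exact: ler_wpM2r.
Qed.

(* the canonical map from E to its bidual *)
Definition bidual_embedding x : dual_space (dual_space E) :=
  DualSpace (evaluation_continuous_linear x).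

End bidual.

Definition duality {R : realType} (E : normedModType R) (x : E)
  (f : dual_space E) : R := f x.

Definition bidual_duality {R : realType} (E : normedModType R)
  (xi : dual_space (dual_space E)) (f : dual_space E) : R := duality f xi.

(* Point-to-set operators are identified with their graphs, so that [T (q, r)]
   reads "r belongs to T(q)". *)
Section monotone_operators.
Context {R : realType} (E F : zmodType) (pairing : E -> F -> R).
Implicit Types S T : set (E * F).

Definition monotone_op T := forall q r q' r',
  T (q, r) -> T (q', r') -> 0 <= pairing (q - q') (r - r').

Definition maximal_monotone_op T :=
  monotone_op T /\ forall S, monotone_op S -> T `<=` S -> S = T.

End monotone_operators.

Section operator_algebra.
Context (E F : zmodType).
Implicit Types S T : set (E * F).

Definition op_range T : set F := [set r | exists q, T (q, r)].

Definition op_translate T (z : E) : set (E * F) :=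
  [set p | T (p.1 + z, p.2)].

Definition op_sum S T : set (E * F) :=
  [set p | exists r s, [/\ S (p.1, r), T (p.1, s) & p.2 = r + s]].

Definition op_swap T : set (F * E) := [set p | T (p.2, p.1)].

End operator_algebra.

(* The tails of a net indexed by a directed preorder generate a filter. *)
Section nets.
Context (I : Type) (le : I -> I -> Prop).

Definition directed_preorder :=
  [/\ exists _ : I, True,
      forall i, le i i,
      forall j i k, le i j -> le j k -> le i k &
      forall i j, exists k, le i k /\ le j k].

Definition net_tails : set_system I :=
  filter_from [set: I] (fun i => [set j | le i j]).

End nets.

(* The weak-star topology sigma(E^*, E) is the topology of pointwise
   convergence on E. *)
Definition weak_star {R : realType} (E : normedModType R) : Type :=
  initial_topology (fun f : dual_space E => (dual_fun f : {ptws E -> R^o})).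

HB.instance Definition _ {R : realType} (E : normedModType R) :=
  Topological.copy (weak_star E)
    (initial_topology
       (fun f : dual_space E => (dual_fun f : {ptws E -> R^o}))).

Section gossez.
Context {R : realType} (X : normedModType R).
Local Notation Xd := (dual_space X).
Local Notation Xdd := (dual_space Xd).
Implicit Types T : set (X * Xd).

Definition gossez_closure T : set (Xdd * Xd) :=
  [set p | forall y g, T (y, g) ->
     0 <= bidual_duality (p.1 - bidual_embedding y) (p.2 - g)].

Definition gossez_type_D T := forall p, gossez_closure T p ->
  exists (I : Type) (le : I -> I -> Prop) (u : I -> X * Xd),
    [/\ directed_preorder le,
        forall i, T (u i),
        [bounded u i | i in [set: I]] &
        (fun i => (bidual_embedding (u i).1, (u i).2)
            : weak_star Xd * Xd) @ net_tails le
          --> (p : weak_star Xd * Xd)].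

Definition type_NI T := forall (f : Xd) (xi : Xdd),
  (ereal_inf [set (bidual_duality (bidual_embedding p.1 - xi) (p.2 - f))%:E
             | p in T] <= 0)%E.

Definition strict_bronsted_rockafellar T :=
  forall (eps : R) (x : X) (f : Xd), 0 < eps ->
  ((- eps)%:E < ereal_inf [set (duality (x - p.1) (f - p.2))%:E | p in T])%E ->
  forall lambda : R, 0 < lambda ->
  exists y g, [/\ T (y, g), `|x - y| < lambda & `|f - g| < eps / lambda].

Definition maximal_monotone_extension T (S : set (Xdd * Xd)) :=
  maximal_monotone_op (@bidual_duality R X) S /\
  forall x f, T (x, f) -> S (bidual_embedding x, f).

End gossez.

(* Convexity of an extended-real-valued function is convexity of its epigraph;
   this avoids the indeterminate sums in the pointwise inequality. *)
Definition convex_efunction {R : realType} (V : lmodType R) (h : V -> \bar R) :=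
  @convex_set R (V * R^o)%type [set q | (h q.1 <= q.2%:E)%E].

Section fitzpatrick.
Context {R : realType} (E : normedModType R).
Local Notation Ed := (dual_space E).
Local Notation Edd := (dual_space Ed).
Implicit Types (T : set (E * Ed)) (h : E * Ed -> \bar R).
Local Open Scope ereal_scope.

Definition fitzpatrick_family T : set (E * Ed -> \bar R) :=
  [set h : E * Ed -> \bar R |
    [/\ convex_efunction h,
        lower_semicontinuous h,
        forall x f, (duality x f)%:E <= h (x, f) &
        forall x f, T (x, f) -> h (x, f) = (duality x f)%:E]].

Definition S_function T (p : E * Ed) : \bar R :=
  ereal_sup [set h p | h in fitzpatrick_family T].

Definition fitzpatrick_function T (p : E * Ed) : \bar R :=
  ereal_sup [set (duality q.1 p.2 + duality p.1 q.2 - duality q.1 q.2)%R%:E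
            | q in T].

Definition fenchel_conjugate h (p : Ed * Edd) : \bar R :=
  ereal_sup [set (duality q.1 p.1 + duality q.2 p.2)%R%:E - h q
            | q in [set: E * Ed]].

Definition shifted_function h (z p : E * Ed) : \bar R :=
  h (p.1 + z.1, p.2 + z.2)%R
  - (duality p.1 z.2 + duality z.1 p.2 + duality z.1 z.2)%R%:E.

Definition eps_subdifferential (eps : R) (k : E -> \bar R) : set (E * Ed) :=
  [set p | forall y, k p.1 + (duality (y - p.1) p.2 - eps)%R%:E <= k y].

Definition half_sqr_norm (x : E) : \bar R := (2^-1 * `|x| ^+ 2)%R%:E.

Definition eps_duality_mapping (eps : R) : set (E * Ed) :=
  eps_subdifferential eps half_sqr_norm.

Definition duality_mapping : set (E * Ed) := eps_subdifferential 0 half_sqr_norm.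

End fitzpatrick.

Arguments eps_duality_mapping {R} E eps.
Arguments duality_mapping {R} E.

(* Main.v *)
(* Write q(x, f) = <x, f>, let h >= q be convex and lower semicontinuous, and let
   energy (x, f) = (|x|^2 + |f|^2) / 2 + q(x, f), which is nonnegative.  The
   infimum in condition 5 at z vanishes iff (h - q)(w) + energy (w - z) can be made
   arbitrarily small in w.  By Fenchel duality this follows from h^* >= q.
   Iterating the approximation, and using the convexity of h to control the steps,
   yields a Cauchy sequence whose limit satisfies h = q, that is, lies in T; this
   is the Bronsted-Rockafellar property.  Hence energy (w - z) can already be made
   small with w in T, which is condition 9.  Conversely, taking z = (0, f - v) with
   v nearly dual to xi turns this density of T into the (NI) inequality at
   (f, xi).  For the exact duality mapping in condition 7 the same argument is
   applied to T + J in place of T.  For type (D), a separation argument shows that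
   every point of the monotone closure is a limit of bounded points z in the convex
   hull of T at which (S_T - q)(z) tends to 0, and the Bronsted-Rockafellar
   property moves these points into T. *)
Require Import Defs.
From HB Require Import structures.
From mathcomp Require Import all_boot all_order all_algebra.
From mathcomp Require Import all_classical all_reals all_analysis.
From mathcomp Require Import ring lra.
Import Order.TTheory GRing.Theory Num.Theory.
Import numFieldNormedType.Exports.
Local Open Scope classical_set_scope.
Local Open Scope ring_scope.

(** * Hahn-Banach *)

(** The obstacle is that the dual of [X * X^*] has a factor in the bidual: separation produces a
    pair [(f, xi)] with [xi] outside [X], so one works with inequalities up to an error, and exact
    contact is recovered only by iteration and completeness. Separation is always a sandwich between
    a convex relation and a finite convex function; a bound of the latter on the unit ball makes the
    separating functional continuous. Conditions 5 and 6 differ only in the choice of [h]. The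
    passage from one [h] to another goes through [energy_dense], which mentions [T] alone. In
    condition 7, moving a point inside [T] would destroy the exact relation with the duality
    mapping. Hence the detour through [sum_rel], whose contact points with the pairing split into a
    point of [T] and one of the duality mapping. For type (D), finitely many functionals are tested
    at a time. Their errors are penalized, and a Lagrange multiplier argument replaces all the
    penalties by one functional on [X]. *)

Section hahn_banach.
Context {R : realType} {V : lmodType R}.
Implicit Types (E M : set (V * R)) (v w : V) (s t : R).

(** Stands for the epigraph of a sublinear function. The last clause makes it proper: a negative
    height above 0 would, by scaling and adding, make every nonempty fibre unbounded below. *)
Definition convex_cone E :=
  [/\ forall v w s t, E (v, s) -> E (w, t) -> E (v + w, s + t),
      forall v s r, 0 <= r -> E (v, s) -> E (r *: v, r * s) &
      forall s, E (0, s) -> 0 <= s].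

Lemma convex_cone_bigcup E (F : set (set (V * R))) : convex_cone E ->
  (forall A, F A -> convex_cone (E `|` A)) -> total_on F subset ->
  convex_cone (E `|` \bigcup_(A in F) A).
Proof.
move=> [ED EZ E0] FE Ftot; split.
- have lift A p : F A -> (E `|` A) p -> (E `|` \bigcup_(A in F) A) p.
    by move=> FA [|Ap]; [left|right; exists A].
  move=> v w s t [Ev|[A FA Av]] [Ew|[B FB Bw]].
  + by left; exact: ED.
  + by have [/(_ _ _ _ _ (or_introl Ev) (or_intror Bw))/(lift _ _ FB)] := FE _ FB.
  + by have [/(_ _ _ _ _ (or_intror Av) (or_introl Ew))/(lift _ _ FA)] := FE _ FA.
  + have [AB|BA] := Ftot _ _ FA FB.
      have [+ _ _] := FE _ FB.
      by move=> /(_ _ _ _ _ (or_intror (AB _ Av)) (or_intror Bw))/(lift _ _ FB).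
    have [+ _ _] := FE _ FA.
    by move=> /(_ _ _ _ _ (or_intror Av) (or_intror (BA _ Bw)))/(lift _ _ FA).
- move=> v s r r0 [Ev|[A FA Av]]; first by left; exact: EZ.
  have [_ /(_ v s r r0 (or_intror Av)) + _] := FE _ FA.
  by move=> [|]; [left|right; exists A].
- move=> s [/E0//|[A FA As]].
  by have [_ _ /(_ s (or_intror As))] := FE _ FA.
Qed.

(** Zorn's lemma runs over the sets whose union with [E] is a cone, so that the empty chain gives
    [E] itself and is no exception. *)
Lemma convex_cone_maximal E : convex_cone E -> exists M,
  [/\ E `<=` M, convex_cone M &
      forall N, M `<=` N -> convex_cone N -> N `<=` M].
Proof.
move=> Econe.
have [|A [EA Amax]] := @Zorn_bigcup _ [set A | convex_cone (E `|` A)].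
  by move=> F FE Ftot; exact: convex_cone_bigcup.
exists (E `|` A); split => //.
move=> N EAN Ncone x Nx; apply: contrapT => EAx.
apply: (Amax N); last by rewrite /= setUidr// => y Ey; apply: EAN; left.
split; last by move=> NA; apply: EAx; right; exact: NA.
by move=> y Ay; apply: EAN; right.
Qed.

(** This is [M] with the ray through [(- v, - c)] adjoined. It stays proper because a height above 0
    comes, after division by [r], from a height above [v], which is at least [c]. *)
Lemma convex_cone_add_ray M v c : convex_cone M ->
  (forall t, M (v, t) -> c <= t) ->
  convex_cone [set p | exists2 r, 0 <= r & M (p.1 + r *: v, p.2 + r * c)].
Proof.
move=> [MD MZ M0] Mv; split => /=.
- move=> w1 w2 s t [r r0 M1] [r' r'0 M2]; exists (r + r'); first exact: addr_ge0.
  by rewrite scalerDl mulrDl addrACA (addrACA s); exact: MD.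
- move=> w s r r0 [r' r'0 Mw]; exists (r * r'); first exact: mulr_ge0.
  by rewrite -scalerA -mulrA -scalerDr -mulrDr; exact: MZ.
- move=> s [r]; rewrite le_eqVlt => /predU1P[<-|r0].
    by rewrite scale0r mul0r !addr0; exact: M0.
  have rV0 : 0 <= r^-1 by rewrite invr_ge0 ltW.
  move=> /(MZ _ _ _ rV0).
  rewrite add0r scalerA mulVf ?gt_eqF// scale1r => /Mv.
  rewrite mulrDr mulrA mulVf ?gt_eqF// mul1r lerDr.
  by rewrite pmulr_rge0 ?invr_gt0.
Qed.

(* In a maximal cone the lower boundary [L] satisfies [M (- v, - L v)], and is
   therefore odd and attained, hence linear. *)
Lemma hahn_banach_cone E : convex_cone E -> (forall v, exists t, E (v, t)) ->
  exists L : V -> R, linear (L : V -> R^o) /\ forall v t, E (v, t) -> L v <= t.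
Proof.
move=> Econe Efib; have [M [EM Mcone Mmax]] := convex_cone_maximal _ Econe.
have [MD MZ M0] := Mcone.
have fib v : [set t | M (v, t)] !=set0.
  by have [t Et] := Efib v; exists t; exact: EM.
have M00 : M (0, 0).
  by have [t /(MZ _ _ 0 (lexx _))] := fib 0; rewrite scale0r mul0r.
have lbd v : has_lbound [set t | M (v, t)].
  have [t Mt] := fib (- v); exists (- t) => s /= Ms.
  have /M0 st : M (0, s + t) by rewrite -(subrr v); exact: MD.
  by lra.
pose L v := inf [set t | M (v, t)].
have Lle v t : M (v, t) -> L v <= t by move=> Mt; exact: ge_inf.
have MN v : M (- v, - L v).
  apply: (Mmax _ _ (convex_cone_add_ray _ _ _ Mcone (Lle v))) => /=.
    by move=> [w t] Mw; exists 0; rewrite ?scale0r ?mul0r ?addr0.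
  by exists 1 => //; rewrite scale1r mul1r !addNr.
have LN v : L (- v) = - L v.
  apply/eqP; rewrite eq_le Lle//=.
  apply: lb_le_inf => // s Ms; rewrite lerNl.
  apply: lb_le_inf => // t Mt; rewrite -subr_ge0 opprK.
  by apply: M0; rewrite -(subrr v); exact: MD.
have ML v : M (v, L v) by have := MN (- v); rewrite LN !opprK.
have LD v w : L (v + w) = L v + L w.
  apply/eqP; rewrite eq_le Lle/=; last exact: MD.
  rewrite -lerN2 -LN Lle// !opprD; exact: MD.
have LZ r v : 0 <= r -> L (r *: v) = r * L v.
  move=> r0; apply/eqP; rewrite eq_le Lle/=; last exact: MZ.
  by rewrite -lerN2 -LN -scalerN -mulrN -LN Lle//; exact: MZ.
exists L; split => [a v w|v t /EM/Lle//].
rewrite LD; congr (_ + _); have [a0|a0] := leP 0 a; first exact: LZ.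
by rewrite -[a]opprK scaleNr LN LZ ?oppr_ge0 ?ltW// -mulNr opprK.
Qed.

End hahn_banach.

(** * The dual space and the sandwich theorem *)

Arguments duality : simpl never.

Section duality_theory.
Context {R : realType} {E : normedModType R}.
Implicit Types (x y : E) (f g : dual_space E) (a c e : R).

Lemma dualityDl x y f : duality (x + y) f = duality x f + duality y f.
Proof. exact: linearD. Qed.

Lemma dualityZl a x f : duality (a *: x) f = a * duality x f.
Proof. exact: linearZ. Qed.

Lemma dualityNl x f : duality (- x) f = - duality x f.
Proof. exact: linearN. Qed.

Lemma dualityBl x y f : duality (x - y) f = duality x f - duality y f.
Proof. exact: linearB. Qed.

Lemma duality0l f : duality 0 f = 0.
Proof. exact: linear0. Qed.

Lemma dualityDr x f g : duality x (f + g) = duality x f + duality x g.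
Proof. by []. Qed.

Lemma dualityZr a x f : duality x (a *: f) = a * duality x f.
Proof. by []. Qed.

Lemma dualityNr x f : duality x (- f) = - duality x f.
Proof. by []. Qed.

Lemma dualityBr x f g : duality x (f - g) = duality x f - duality x g.
Proof. by []. Qed.

Lemma normr_duality x f : `|duality x f| <= `|x| * `|f|.
Proof. by rewrite mulrC; exact: le_dual_norm. Qed.

Lemma duality_ge x f : - (`|x| * `|f|) <= duality x f.
Proof. by have := normr_duality x f; rewrite ler_norml => /andP[]. Qed.

Lemma duality_le x f : duality x f <= `|x| * `|f|.
Proof. by have := normr_duality x f; rewrite ler_norml => /andP[]. Qed.

Lemma bounded_linear_dual (L : E -> R) c : linear (L : E -> R^o) ->
  (forall x, `|L x| <= c * `|x|) -> exists f, forall x, duality x f = L x.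
Proof.
move=> lL Lc; pose l : {linear E -> R^o} :=
  HB.pack (L : E -> R^o) (GRing.isLinear.Build R _ R^o _ _ lL).
have cl : continuous l.
  apply: bounded_linear_continuous; apply/bounded_funP => r.
  exists (`|c| * r) => x xr; apply: (le_trans (Lc x)).
  by apply: (le_trans (ler_wpM2r _ (ler_norm c))) => //; exact: ler_wpM2l.
have lc : (L : E -> R^o) \in @continuous_linear R E by exact/asboolP.
by exists (DualSpace lc).
Qed.

Lemma dual_norm_approx f e : 0 < e ->
  exists2 x, `|x| <= 1 & `|f| - e < duality x f.
Proof.
move=> e0; have [_ [x /= x1 <-]] := sup_adherent e0 (dual_norm_has_sup f).
rewrite -/(dual_norm f) => fx; have [f0|f0] := leP 0 (duality x f).
  exists x => //; rewrite -[duality x f]ger0_norm //.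
exists (- x); first by rewrite normrN.
by rewrite dualityNl; have <- : `|f x| = - duality x f by rewrite ltr0_norm.
Qed.

(** The infimum of [f] on the ball of radius [c] is [- (c * |f|)], possibly not attained; the slack
    [e / (c + 1)] also covers [c = 0]. *)
Lemma dual_norm_bound f c (d : R) : 0 <= c ->
  (forall x, `|x| <= c -> d <= duality x f) -> d <= - (c * `|f|).
Proof.
move=> c0 df; apply/ler_addgt0Pr => e e0; have c1 : 0 < c + 1 by lra.
have [x x1 fx] := dual_norm_approx f (e / (c + 1)) (divr_gt0 e0 c1).
have /df : `|- (c *: x)| <= c.
  by rewrite normrN normrZ ger0_norm// ler_piMr.
rewrite dualityNl dualityZl => dx.
have : c * (`|f| - e / (c + 1)) <= c * duality x f.
  by rewrite ler_wpM2l// ltW.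
have : c * (e / (c + 1)) <= e.
  rewrite mulrCA ger_pMr// ler_pdivrMr//; lra.
nra.
Qed.

Definition dualityE :=
  (dualityDl, dualityDr, dualityNl, dualityNr, dualityZl, dualityZr).

End duality_theory.

Lemma dual_prod {R : realType} {E F : normedModType R}
    (L : dual_space (E * F)%type) :
  exists (f : dual_space E) (g : dual_space F), forall x y,
    duality (x, y) L = duality x f + duality y g.
Proof.
have [|x|f fE] := @bounded_linear_dual R E (fun x => duality (x, 0) L) `|L|.
- move=> a x y; have -> : (a *: x + y, 0 : F) = a *: (x, 0) + (y, 0).
    by congr pair; rewrite /= scaler0 addr0.
  by rewrite dualityDl dualityZl.
- apply: (le_trans (normr_duality _ _)); rewrite mulrC ler_wpM2l//.
  by rewrite prod_normE ge_max/= lexx normr0/= ?normr_ge0.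
have [|y|g gE] := @bounded_linear_dual R F (fun y => duality (0, y) L) `|L|.
- move=> a x y; have -> : (0 : E, a *: x + y) = a *: (0, x) + (0, y).
    by congr pair; rewrite /= scaler0 addr0.
  by rewrite dualityDl dualityZl.
- apply: (le_trans (normr_duality _ _)); rewrite mulrC ler_wpM2l//.
  by rewrite prod_normE ge_max/= lexx normr0/= ?normr_ge0.
exists f, g => x y; rewrite fE gE -dualityDl; congr duality.
by congr pair; rewrite /= ?addr0 ?add0r.
Qed.

Section sandwich.
Context {R : realType}.

(* Extended-real-valued functions [h] are handled through their epigraphs:
   [C v t] stands for [h v <= t]. *)
Definition convex_rel {V : lmodType R} (C : V -> R -> Prop) :=
  forall u v t r s, 0 <= s <= 1 -> C u t -> C v r ->
  C (s *: u + (1 - s) *: v) (s * t + (1 - s) * r).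

Definition convex_fun {V : lmodType R} (k : V -> R) :=
  forall u v s, 0 <= s <= 1 ->
  k (s *: u + (1 - s) *: v) <= s * k u + (1 - s) * k v.

(** The vectors [u - w] with heights [t + k w] generate a cone; above 0 one has [u = w], so the
    assumed inequality makes it proper. A linear minorant [L] of the cone satisfies
    [L u - t <= L w + k w], and [a] is the supremum of the left sides. *)
Lemma linear_sandwich {V : lmodType R} (C : V -> R -> Prop) (k : V -> R) :
  convex_rel C -> (exists u t, C u t) -> convex_fun k ->
  (forall u t, C u t -> 0 <= t + k u) ->
  exists (L : V -> R) (a : R), [/\ linear (L : V -> R^o),
    forall u t, C u t -> L u - a <= t & forall w, a - L w <= k w].
Proof.
move=> Ccvx [u0 [t0 C0]] kcvx Ck.
pose E : set (V * R) := [set p | exists u t w r,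
  [/\ C u t, 0 <= r, p.1 = r *: (u - w) & r * (t + k w) <= p.2]].
have Econe : convex_cone E.
  split.
  - move=> v1 v2 s1 s2 [u1 [t1 [w1 [r1 [/= C1 r1_ge0 -> s1_ge]]]]].
    move=> [u2 [t2 [w2 [r2 [/= C2 r2_ge0 -> s2_ge]]]]].
    have [r0|r0] := eqVneq (r1 + r2) 0.
      have [r10 r20] : r1 = 0 /\ r2 = 0 by split; lra.
      exists u1, t1, w1, 0; split => //=; first by rewrite r10 r20 !scale0r addr0.
      by move: s1_ge s2_ge; rewrite r10 r20 !mul0r; lra.
    have r_gt0 : 0 < r1 + r2 by rewrite lt0r r0 addr_ge0.
    pose s := r1 / (r1 + r2).
    have s01 : 0 <= s <= 1.
      by rewrite /s divr_ge0 ?(ltW r_gt0)//= ler_pdivrMr// mul1r lerDl.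
    have rs : (r1 + r2) * s = r1 by rewrite mulrC divfK.
    clearbody s; have rs' : (r1 + r2) * (1 - s) = r2 by lra.
    exists (s *: u1 + (1 - s) *: u2), (s * t1 + (1 - s) * t2),
      (s *: w1 + (1 - s) *: w2), (r1 + r2); split => /=.
    + exact: Ccvx.
    + exact: ltW.
    + by rewrite opprD addrACA -!scalerBr [RHS]scalerDr !scalerA rs rs'.
    + have rE a b : (r1 + r2) * (s * a + (1 - s) * b) = r1 * a + r2 * b.
        by rewrite mulrDr !mulrA rs rs'.
      have := ler_wpM2l (ltW r_gt0) (kcvx w1 w2 s s01); rewrite rE.
      by rewrite mulrDr rE; lra.
  - move=> v s r r0 [u [t [w [r' [/= C1 r'0 -> sge]]]]].
    exists u, t, w, (r * r'); split => //=; first exact: mulr_ge0.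
      by rewrite scalerA.
    by rewrite -mulrA ler_wpM2l.
  - move=> s [u [t [w [r [/= C1 r_ge0 + sge]]]]].
    move/esym/eqP; rewrite scaler_eq0 => /orP[/eqP r0|].
      by move: sge; rewrite r0 mul0r.
    rewrite subr_eq0 => /eqP uw; apply: le_trans sge.
    by rewrite mulr_ge0// -uw Ck.
have [|L [lL LE]] := hahn_banach_cone _ Econe.
  move=> v; exists (1 * (t0 + k (u0 - v))), u0, t0, (u0 - v), 1; split => //=.
  by rewrite scale1r opprB addrC subrK.
have LB u v : L (u - v) = L u - L v.
  by rewrite addrC -scaleN1r lL scaleN1r addrC.
have LC u t w : C u t -> L u - t <= L w + k w.
  move=> Cut; suff : L (u - w) <= t + k w by rewrite LB; lra.
  by apply: LE; exists u, t, w, 1; split; rewrite ?scale1r ?mul1r.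
pose A := [set r | exists u t, C u t /\ r = L u - t].
have A0 : A !=set0 by exists (L u0 - t0), u0, t0.
exists L, (sup A); split => // [u t Cut|w].
  rewrite lerBlDl -lerBlDr; apply: ub_le_sup; last by exists u, t.
  by exists (L 0 + k 0) => _ [u' [t' [Cut' ->]]]; exact: LC.
rewrite lerBlDl; apply: ge_sup => // _ [u [t [Cut ->]]]; exact: LC.
Qed.

(** The bound [m] on the unit ball bounds [- L] there, and by symmetry [L], which is therefore
    continuous. *)
Lemma sandwich {V : normedModType R} (C : V -> R -> Prop) (k : V -> R) (m : R) :
  convex_rel C -> (exists u t, C u t) -> convex_fun k ->
  (forall v, `|v| <= 1 -> k v <= m) ->
  (forall u t, C u t -> 0 <= t + k u) ->
  exists (L : dual_space V) (a : R),
    (forall u t, C u t -> duality u L - a <= t) /\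
    (forall w, a - duality w L <= k w).
Proof.
move=> Ccvx C0 kcvx km Ck.
have [L [a [lL LC Lk]]] := linear_sandwich _ _ Ccvx C0 kcvx Ck.
have L0 : L 0 = 0 by have := lL (-1) 0 0; rewrite scaler0 addr0 scaleN1r addNr.
have LZ r v : L (r *: v) = r * L v.
  by have := lL r v 0; rewrite !addr0 => ->; rewrite L0 addr0.
have L1 v : `|v| <= 1 -> - L v <= m - a.
  by move=> v1; have := Lk v; have := km v v1; lra.
have Lb v : `|L v| <= (m - a) * `|v|.
  have [->|v0] := eqVneq v 0; first by rewrite L0 !normr0 mulr0.
  have nv0 : 0 < `|v| by rewrite normr_gt0.
  have v1 : `|(`|v|^-1 *: v)| <= 1.
    by rewrite normrZ normfV normr_id mulVf ?normr_eq0.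
  rewrite -ler_pdivrMr//.
  have -> : `|L v| / `|v| = `|L (`|v|^-1 *: v)|.
    by rewrite LZ normrM normfV normr_id mulrC.
  have LN w : L (- w) = - L w by rewrite -scaleN1r LZ mulN1r.
  by rewrite ler_norml lerNl L1//= -[L _]opprK -LN L1// normrN.
have [F FL] := bounded_linear_dual _ _ lL Lb.
by exists F, a; split => [u t /LC|w]; rewrite FL.
Qed.

End sandwich.

(** * The energy and Fenchel duality *)

Section convex_functions.
Context {R : realType}.

Lemma convex_funD {V : lmodType R} (k l : V -> R) : convex_fun k ->
  convex_fun l -> convex_fun (fun v => k v + l v).
Proof.
by move=> kc lc u v s s01; have := kc u v s s01; have := lc u v s s01; lra.
Qed.

Lemma convex_funZ {V : lmodType R} (a : R) (k : V -> R) : 0 <= a ->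
  convex_fun k -> convex_fun (fun v => a * k v).
Proof.
by move=> a0 kc u v s s01; have := ler_wpM2l a0 (kc u v s s01); lra.
Qed.

Lemma convex_fun_cst {V : lmodType R} (a : R) : convex_fun (fun _ : V => a).
Proof. by move=> u v s _; lra. Qed.

Lemma convex_fun_fst {E F : lmodType R} (k : E -> R) : convex_fun k ->
  convex_fun (fun z : E * F => k z.1).
Proof. by move=> kc u v; exact: kc. Qed.

Lemma convex_fun_snd {E F : lmodType R} (k : F -> R) : convex_fun k ->
  convex_fun (fun z : E * F => k z.2).
Proof. by move=> kc u v; exact: kc. Qed.

Lemma sqr_norm_convex {V : normedModType R} (u v : V) (s : R) : 0 <= s <= 1 ->
  `|s *: u + (1 - s) *: v| ^+ 2 <= s * `|u| ^+ 2 + (1 - s) * `|v| ^+ 2.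
Proof.
move=> /andP[s0 s1].
have h : `|s *: u + (1 - s) *: v| <= s * `|u| + (1 - s) * `|v|.
  apply: (le_trans (ler_normD _ _)).
  by rewrite !normrZ !ger0_norm ?subr_ge0.
have h0 := normr_ge0 (s *: u + (1 - s) *: v).
have : `|s *: u + (1 - s) *: v| ^+ 2 <= (s * `|u| + (1 - s) * `|v|) ^+ 2.
  by rewrite ler_pXn2r// nnegrE ?(le_trans h0).
move=> /le_trans; apply; rewrite -subr_ge0.
have -> : s * `|u| ^+ 2 + (1 - s) * `|v| ^+ 2 - (s * `|u| + (1 - s) * `|v|) ^+ 2
  = s * (1 - s) * (`|u| - `|v|) ^+ 2 by ring.
by rewrite mulr_ge0 ?sqr_ge0// mulr_ge0// subr_ge0.
Qed.

Lemma sqr_dist_convex {V : normedModType R} (v0 : V) :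
  convex_fun (fun v => `|v - v0| ^+ 2).
Proof.
move=> u v s s01.
have -> : s *: u + (1 - s) *: v - v0 = s *: (u - v0) + (1 - s) *: (v - v0).
  by rewrite !scalerBr addrACA -opprD -scalerDl [s + _]addrC subrK scale1r.
exact: sqr_norm_convex.
Qed.

End convex_functions.

Section energy.
Context {R : realType} {E : normedModType R}.
Implicit Types (x y : E) (f g : dual_space E) (z w p : E * dual_space E).
Implicit Types (C H : E * dual_space E -> R -> Prop) (c t s : R).

Definition pairing z : R := duality z.1 z.2.

(** The gap in the Fenchel-Young inequality for [c / 2 * |.|^2] at [(z.1, - z.2)]. The weight [c]
    allows the accuracies in the two factors to be traded against each other. *)
Definition energy c z : R :=
  2^-1 * (c * `|z.1| ^+ 2 + c^-1 * `|z.2| ^+ 2) + pairing z.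

Lemma energy_ge c z : 0 < c ->
  2^-1 * c * (`|z.1| - c^-1 * `|z.2|) ^+ 2 <= energy c z.
Proof.
move=> c0; have := duality_ge z.1 z.2; rewrite /energy /pairing.
set a := `|z.1|; set b := `|z.2|; set d := duality _ _ => abd.
have -> : 2^-1 * c * (a - c^-1 * b) ^+ 2 =
    2^-1 * (c * a ^+ 2 + c^-1 * b ^+ 2) - a * b.
  by field; rewrite gt_eqF.
by lra.
Qed.

Lemma energy_ge0 c z : 0 < c -> 0 <= energy c z.
Proof.
move=> c0; apply: le_trans (energy_ge _ _ c0).
by rewrite mulr_ge0 ?sqr_ge0// mulr_ge0// ?invr_ge0// ltW.
Qed.

Lemma linear_quadratic_bound c f (d r : R) : 0 < c -> 0 <= r ->
  (forall x, d <= duality x f + 2^-1 * c * `|x| ^+ 2) ->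
  d <= 2^-1 * c * r ^+ 2 - r * `|f|.
Proof.
move=> c0 r0 df; rewrite -lerBlDl.
apply: dual_norm_bound => // x xr; have := df x.
have : `|x| ^+ 2 <= r ^+ 2 by rewrite ler_pXn2r ?nnegrE.
by nra.
Qed.

(** The conjugate of [c / 2 * |.|^2] is [|.|^2 / (2 * c)]: the radius [c^-1 * |f|] minimizes the
    bound of the preceding lemma. *)
Lemma linear_quadratic_le c f (d : R) : 0 < c ->
  (forall x, d <= duality x f + 2^-1 * c * `|x| ^+ 2) ->
  d <= - (2^-1 * c^-1 * `|f| ^+ 2).
Proof.
move=> c0 df; have := linear_quadratic_bound _ _ _ (c^-1 * `|f|) c0 _ df.
rewrite mulr_ge0 ?invr_ge0 ?(ltW c0)// => /(_ isT)/le_trans; apply.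
rewrite le_eqVlt; apply/orP; left; apply/eqP; field.
by rewrite gt_eqF.
Qed.

(** The pairing is not convex, but [pairing (z - z0) - pairing z] is affine in [z], so only two
    squared norms and an affine term remain. *)
Lemma energy_convex c z0 : 0 < c ->
  convex_fun (fun z => energy c (z - z0) - pairing z).
Proof.
move=> c0; pose l z := pairing z0 - duality z0.1 z.2 - duality z.1 z0.2.
have -> : (fun z => energy c (z - z0) - pairing z) = (fun z =>
    2^-1 * c * `|z.1 - z0.1| ^+ 2 + 2^-1 * c^-1 * `|z.2 - z0.2| ^+ 2 + l z).
  apply/funext => z; rewrite /l /energy /pairing /= !dualityE.
  by move: (`|z.1 - _| ^+ 2) (`|z.2 - _| ^+ 2) => m n; ring.
have lcvx : convex_fun l by move=> u v s s01; rewrite /l /= !dualityE; lra.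
have h1 := convex_fun_fst (F := dual_space E) _ (sqr_dist_convex z0.1).
have h2 := convex_fun_snd (E := E) _ (sqr_dist_convex z0.2).
have p1 : 0 <= 2^-1 * c by rewrite mulr_ge0// ltW.
have p2 : 0 <= 2^-1 * c^-1 by rewrite mulr_ge0// invr_ge0 ltW.
exact: convex_funD _ _
  (convex_funD _ _ (convex_funZ _ _ p1 h1) (convex_funZ _ _ p2 h2)) lcvx.
Qed.

Lemma energy_bounded c : 0 < c -> forall z0, exists m : R, forall z, `|z| <= 1 ->
  energy c (z - z0) - pairing z <= m.
Proof.
move=> c0 [x0 g0].
exists (2^-1 * (c * (1 + `|x0|) ^+ 2 + c^-1 * (1 + `|g0|) ^+ 2)
   + `|g0| + `|x0| + duality x0 g0) => -[x f].
rewrite prod_normE ge_max/= => /andP[x1 f1].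
rewrite /energy /pairing/=.
have bnd (V : normedModType R) (u u0 : V) : `|u| <= 1 ->
    `|u - u0| ^+ 2 <= (1 + `|u0|) ^+ 2.
  move=> u1; rewrite ler_pXn2r ?nnegrE ?addr_ge0//.
  by apply: (le_trans (ler_normB _ _)); rewrite lerD2r.
have h1 : c * `|x - x0| ^+ 2 <= c * (1 + `|x0|) ^+ 2 by rewrite ler_pM2l ?bnd.
have h2 : c^-1 * `|f - g0| ^+ 2 <= c^-1 * (1 + `|g0|) ^+ 2.
  by rewrite ler_pM2l ?invr_gt0 ?bnd.
have h3 : - duality x g0 <= `|g0|.
  rewrite lerNl; apply: le_trans (duality_ge _ _).
  by rewrite lerN2 ler_piMl.
have h4 : - duality x0 f <= `|x0|.
  rewrite lerNl; apply: le_trans (duality_ge _ _).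
  by rewrite lerN2 ler_piMr.
rewrite !dualityE; lra.
Qed.

End energy.

Section fenchel_duality.
Context {R : realType} {E : normedModType R}.
Implicit Types (C : E * dual_space E -> R -> Prop) (c : R).

(** If every value were at least [eps], a sandwich would give [(f, xi)] and [a]. The lower side
    yields [duality f xi <= a] by hypothesis; the upper side, minimized in both variables, yields
    [a - duality f xi + eps] plus an energy of [(f - g0, eta)] at most 0, which is absurd. *)
Lemma fenchel_approx C c : 0 < c -> convex_rel C -> (exists z t, C z t) ->
  (forall f (xi : dual_space (dual_space E)) a,
     (forall x g t, C (x, g) t -> duality x f + duality g xi - a <= t) ->
     duality f xi <= a) ->
  forall z0 (eps : R), 0 < eps ->
  exists z t, C z t /\ t - pairing z + energy c (z - z0) < eps.
Proof.
move=> c0 Ccvx C0 Cconj z0 eps eps0; apply: contrapT => nC.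
have [m mb] := energy_bounded c c0 z0.
have [||u t Cut|L [a [La Lk]]] := sandwich C
  (fun z => energy c (z - z0) - pairing z - eps) m Ccvx C0.
- exact: convex_funD _ _ (energy_convex c z0 c0) (convex_fun_cst _).
- by move=> v /mb; lra.
- rewrite leNgt; apply/negP => lt0; apply: nC; exists u, t; split => //; lra.
have [f [xi LE]] := dual_prod L.
have /Cconj fxi : forall x g t, C (x, g) t -> duality x f + duality g xi - a <= t.
  by move=> x g t /La; rewrite LE.
case: z0 => x0 g0 in mb Lk nC *.
pose eta := xi - bidual_embedding x0.
have LkE y h : a - duality x0 f - duality g0 xi + duality x0 g0 + eps <=
    duality y (f - g0) + 2^-1 * c * `|y| ^+ 2 +
    (duality h eta + 2^-1 * c^-1 * `|h| ^+ 2).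
  have := Lk (x0 + y, g0 + h); rewrite LE /energy /pairing /=.
  rewrite !(addrC x0) !(addrC g0) !addrK.
  have -> : duality h eta = duality h xi - duality x0 h by [].
  by rewrite !dualityE; lra.
(* The variables [y] and [h] are separated in [LkE], so each is minimized on its own. *)
have h1 : a - duality x0 f - duality g0 xi + duality x0 g0 + eps <=
    - (2^-1 * c^-1 * `|f - g0| ^+ 2) - (2^-1 * c^-1^-1 * `|eta| ^+ 2).
  rewrite -lerBlDr.
  apply: linear_quadratic_le => // y; rewrite lerBlDr -lerBlDl.
  apply: linear_quadratic_le; first by rewrite invr_gt0.
  by move=> h; rewrite lerBlDl.
(* Conjugation inverts the weight, hence [c^-1] for the energy between dual and bidual. *)
have := energy_ge0 c^-1 (f - g0, eta); rewrite invr_gt0 => /(_ c0).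
rewrite /energy /pairing /=.
have -> : duality (f - g0) eta =
    duality f xi - duality g0 xi - (duality x0 f - duality x0 g0).
  by rewrite dualityBr !dualityBl.
have := fxi.
lra.
Qed.

End fenchel_duality.

(** * Completeness along geometric sequences *)

Section geometric_sequences.
Context {R : realType}.

Lemma exp_lt_eventually (rho e : R) : 0 <= rho < 1 -> 0 < e ->
  exists k, rho ^+ k < e.
Proof.
move=> /andP[rho0 rho1] e0.
have /cvg_expr/cvgrPdist_lt/(_ _ e0)[k _ /(_ k (leqnn k))] : `|rho| < 1.
  by rewrite ger0_norm.
by rewrite sub0r normrN /= ger0_norm ?exprn_ge0// => ?; exists k.
Qed.

Definition geometric_step {V : normedModType R} (u : nat -> V) (M rho : R) :=
  forall k, `|u k.+1 - u k| <= M * rho ^+ k.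

Lemma geometric_step_dist {V : normedModType R} (u : nat -> V) (M rho : R) :
  0 <= rho < 1 -> 0 <= M -> geometric_step u M rho ->
  forall k n, `|u (k + n)%N - u k| <= M * rho ^+ k / (1 - rho).
Proof.
move=> /andP[rho0 rho1] M0 uM k n.
have rho1' : 0 < 1 - rho by rewrite subr_gt0.
suff h : `|u (k + n)%N - u k| <= M * rho ^+ k * (1 - rho ^+ n) / (1 - rho).
  apply: (le_trans h); rewrite ler_pM2r ?invr_gt0// ler_piMr//.
    by rewrite mulr_ge0// exprn_ge0.
  by rewrite gerBl exprn_ge0.
elim: n => [|n IH]; first by rewrite addn0 subrr normr0 expr0 subrr mulr0 mul0r.
rewrite addnS -(subrK (u (k + n)%N) (u (k + n).+1)) -addrA.
apply: (le_trans (ler_normD _ _)).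
apply: (le_trans (lerD (uM _) IH)); rewrite le_eqVlt; apply/orP; left.
by apply/eqP; rewrite exprD exprS; field; rewrite gt_eqF.
Qed.

(** Completeness in the form needed by the iteration. The explicit rate is uniform over the unit
    ball for functionals, which is how the dual is shown to have the property. *)
Definition geometrically_complete (V : normedModType R) :=
  forall (u : nat -> V) (M rho : R), 0 <= rho < 1 -> 0 <= M ->
  geometric_step u M rho ->
  exists l, forall k, `|u k - l| <= M * rho ^+ k / (1 - rho).

Lemma complete_geometrically_complete (V : completeNormedModType R) :
  geometrically_complete V.
Proof.
move=> u M rho rho01 M0 uM; have [rho0 rho1] := andP rho01.
have rho1' : 0 < 1 - rho by rewrite subr_gt0.
have dist := geometric_step_dist u M rho rho01 M0 uM.
have small (e : R) : 0 < e -> exists k, M * rho ^+ k / (1 - rho) < e.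
  move=> e0; have e1 : 0 < e * (1 - rho) / (M + 1).
    by rewrite !(mulr_gt0, invr_gt0)// ltr_wpDl.
  have [k hk] := exp_lt_eventually rho _ rho01 e1; exists k.
  rewrite ltr_pdivrMr//; move: hk; rewrite ltr_pdivlMr ?ltr_wpDl//.
  by have := exprn_ge0 k rho0; nra.
have cu : cauchy (u @ \oo).
  apply: cauchy_exP => e e0; have [k hk] := small e e0.
  exists (u k); exists k => // n /= kn.
  rewrite -ball_normE /= distrC -(subnKC kn).
  exact: le_lt_trans (dist _ _) hk.
have /cvg_ex[l ul] : cvg (u @ \oo) by exact: cauchy_cvg.
exists l => k; apply/ler_addgt0Pr => e e0.
have /cvgrPdist_lt/(_ _ e0)[n _ /(_ (k + n)%N (leq_addl _ _)) lu] := ul.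
rewrite -(subrK (u (k + n)%N) (u k)) -addrA; apply: (le_trans (ler_normD _ _)).
by apply: lerD; [rewrite distrC; exact: dist|rewrite distrC ltW].
Qed.

(** The values at each [x] converge at a rate proportional to [|x|]. Linearity and boundedness pass
    to the pointwise limit, and the rate becomes a bound in the dual norm. *)
Lemma dual_geometrically_complete (V : normedModType R) :
  geometrically_complete (dual_space V).
Proof.
move=> u M rho rho01 M0 uM; have [rho0 rho1] := andP rho01.
have rho1' : 0 < 1 - rho by rewrite subr_gt0.
have lim x : exists l : R, forall k,
    `|duality x (u k) - l| <= `|x| * M * rho ^+ k / (1 - rho).
  apply: (complete_geometrically_complete R^o (fun k => duality x (u k))) => //.
    by rewrite mulr_ge0.
  move=> k; rewrite -dualityBr; apply: (le_trans (normr_duality _ _)).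
  by rewrite -mulrA ler_wpM2l.
have /choice[g gE] := lim.
have uniq (a b : R) : (forall k, `|a| <= b * rho ^+ k) -> a = 0.
  move=> ab; apply/eqP; rewrite -normr_eq0 eq_le normr_ge0 andbT.
  rewrite leNgt; apply/negP => a0.
  have b1 : 0 < `|b| + 1 by rewrite ltr_wpDl.
  have [k] := exp_lt_eventually rho _ rho01 (divr_gt0 a0 b1).
  rewrite ltr_pdivlMr//; have := ab k; have := exprn_ge0 k rho0.
  by have := ler_norm b; nra.
have lin : linear (g : V -> R^o).
  move=> a x y; apply/eqP; rewrite -subr_eq0; apply/eqP.
  apply: (uniq _ ((`|a *: x + y| + `|a| * `|x| + `|y|) * M / (1 - rho))) => k.
  have -> : g (a *: x + y) - (a *: (g x : R^o) + g y) =
      - (duality (a *: x + y) (u k) - g (a *: x + y)) +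
      (a * (duality x (u k) - g x) + (duality y (u k) - g y)).
    by rewrite !dualityE /GRing.scale/=; ring.
  rewrite !mulrDl; apply: (le_trans (ler_normD _ _)); rewrite normrN -addrA.
  apply: lerD; first by rewrite mulrAC; exact: gE.
  apply: (le_trans (ler_normD _ _)); apply: lerD.
    by rewrite normrM -!mulrA ler_wpM2l// !mulrA mulrAC; exact: gE.
  by rewrite mulrAC; exact: gE.
have bnd x : `|g x| <= (M / (1 - rho) + `|u 0%N|) * `|x|.
  have := gE x 0%N; rewrite expr0 mulr1.
  have := normr_duality x (u 0%N).
  rewrite mulrDl => h1 h2.
  rewrite -(subrK (duality x (u 0%N)) (g x)).
  apply: (le_trans (ler_normD _ _)); apply: lerD; last by rewrite mulrC.
  by rewrite distrC mulrC mulrA.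
have [f fE] := bounded_linear_dual _ _ lin bnd.
exists f => k; apply: dual_norm_le.
  by rewrite !(mulr_ge0, invr_ge0)// ?exprn_ge0// ltW.
move=> x; have := gE x k; rewrite -fE -dualityBr => /le_trans; apply.
by rewrite -!mulrA mulrC -!mulrA.
Qed.

End geometric_sequences.

(** * The Bronsted-Rockafellar property *)

Section bronsted_rockafellar.
Context {R : realType} {E : normedModType R}.
Implicit Types (z w p : E * dual_space E) (H : E * dual_space E -> R -> Prop).
Implicit Types (a b c e r s t : R).

Definition above_pairing H := forall z t, H z t -> pairing z <= t.

(** For an epigraph this is lower semicontinuity; the height [s] is bounded on one side only because
    epigraphs are closed upwards. *)
Definition closed_rel H := forall z t,
  (forall e, 0 < e -> exists w s,
     [/\ H w s, `|w.1 - z.1| < e, `|w.2 - z.2| < e & s < t + e]) ->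
  H z t.

Definition energy_approximable H c := forall z e, 0 < e ->
  exists w t, H w t /\ t - pairing w + energy c (w - z) < e.

Lemma pairing_conv z w s : pairing (s *: z + (1 - s) *: w) =
  s * pairing z + (1 - s) * pairing w - s * (1 - s) * pairing (z - w).
Proof. by rewrite /pairing /= !dualityE; ring. Qed.

(** At [l *: z + (1 - l) *: w] the pairing differs from the interpolated value by
    [l * (1 - l) * pairing (z - w)], while the interpolated height cannot fall below it. *)
Lemma gap_pairing_ge H z w t s a b : convex_rel H -> above_pairing H ->
  H z t -> H w s -> 0 < a -> 0 < b ->
  t - pairing z <= a ^+ 2 -> s - pairing w <= b ^+ 2 ->
  - pairing (z - w) <= (a + b) ^+ 2.
Proof.
move=> Hcvx Hq Hz Hw a0 b0 ta sb.
have ab0 : 0 < a + b by rewrite addr_gt0.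
(* This weight minimizes [a^2 / (1 - l) + b^2 / l], with minimum [(a + b)^2]. *)
pose l := b / (a + b); have lab : l * (a + b) = b by rewrite divfK ?gt_eqF.
have l01 : 0 <= l <= 1.
  by rewrite /l divr_ge0 ?(ltW ab0) ?(ltW b0)//= ler_pdivrMr// mul1r lerDr ltW.
have := Hq _ _ (Hcvx _ _ _ _ _ l01 Hz Hw); rewrite pairing_conv.
clearbody l; set d := pairing (z - w) => h.
have [l0 l1] := andP l01.
have h1 : - (l * (1 - l)) * d <= l * a ^+ 2 + (1 - l) * b ^+ 2 by nra.
have h2 : - (l * (1 - l)) * d * (a + b) ^+ 2 = - d * (a * b).
  have -> : - (l * (1 - l)) * d * (a + b) ^+ 2 =
    - d * (l * (a + b) * ((a + b) - l * (a + b))) by ring.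
  by rewrite lab; ring.
have h3 : (l * a ^+ 2 + (1 - l) * b ^+ 2) * (a + b) ^+ 2 =
    (a + b) ^+ 2 * (a * b).
  have -> : (l * a ^+ 2 + (1 - l) * b ^+ 2) * (a + b) ^+ 2 =
    (a + b) * (l * (a + b) * a ^+ 2 + ((a + b) - l * (a + b)) * b ^+ 2) by ring.
  by rewrite lab; ring.
have ab_gt0 : 0 < a * b by rewrite mulr_gt0.
by rewrite -(ler_pM2r ab_gt0) -h2 -h3 ler_pM2r// exprn_gt0.
Qed.

(** A small energy makes [r * |w.1 - z.1|] and [|w.2 - z.2| / r] nearly equal, and [gap_pairing_ge]
    bounds their half sum of squares by [b^2 + (a + b)^2]. The coefficient 1 of [a] is what keeps
    the total displacement below [e] in [bronsted_rockafellar]. *)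
Lemma energy_gap_step H z w t s a b r : convex_rel H -> above_pairing H ->
  H z t -> H w s -> 0 < a -> 0 < b -> 0 < r -> t - pairing z <= a ^+ 2 ->
  s - pairing w + energy (r ^+ 2) (w - z) < b ^+ 2 ->
  r * `|w.1 - z.1| <= a + 4 * b /\ `|w.2 - z.2| <= r * (a + 4 * b).
Proof.
move=> Hcvx Hq Hz Hw a0 b0 r0 ta sb.
have r20 : 0 < r ^+ 2 by rewrite exprn_gt0.
have e0 := energy_ge _ (w - z) r20.
have e1 := energy_ge0 _ (w - z) r20.
have gw : 0 <= s - pairing w by rewrite subr_ge0; exact: Hq.
have dge : - pairing (w - z) <= (a + b) ^+ 2.
  have -> : pairing (w - z) = pairing (z - w) by rewrite /pairing/= !dualityE; ring.
  by apply: (gap_pairing_ge H z w t s) => //; lra.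
have : energy (r ^+ 2) (w - z) < b ^+ 2 by lra.
move: e0; rewrite /energy /= in dge *.
set u := `|w.1 - z.1|; set v := `|w.2 - z.2|; set d := pairing (w - z).
rewrite -/d in dge.
pose v' := r^-1 * v; have vE : v = r * v' by rewrite /v' mulrA divff ?gt_eqF ?mul1r.
rewrite vE.
have -> : 2^-1 * r ^+ 2 * (u - r ^- 2 * (r * v')) ^+ 2 = 2^-1 * (r * u - v') ^+ 2.
  by field; rewrite gt_eqF.
have -> : r ^+ 2 * u ^+ 2 + r ^- 2 * (r * v') ^+ 2 = (r * u) ^+ 2 + v' ^+ 2.
  by field; rewrite gt_eqF.
have u0 : 0 <= r * u by rewrite mulr_ge0 ?(ltW r0) ?normr_ge0.
have v0 : 0 <= v' by rewrite mulr_ge0 ?invr_ge0 ?(ltW r0) ?normr_ge0.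
move: (r * u) u0 => {}u u0 h1 h2.
rewrite ler_pM2l//.
have key (x y : R) : 0 <= x -> 0 <= y -> (x - y) ^+ 2 < 2 * b ^+ 2 ->
    2^-1 * (x ^+ 2 + y ^+ 2) < b ^+ 2 + (a + b) ^+ 2 -> x <= a + 4 * b.
  move=> x0 y0 xy xy2; rewrite leNgt; apply/negP => ltx.
  (* [3 / 2] is a rational bound above the square root of 2, so the second case contradicts the
     bound on [(x - y)^2]. *)
  have [hy|hy] := leP (x - y) (3 / 2 * b).
    by nra.
  by nra.
split; [apply: (key u v')|apply: (key v' u)] => //; nra.
Qed.

Lemma pairing_dist_le z w d : 0 <= d -> d <= 1 ->
  `|z.1 - w.1| <= d -> `|z.2 - w.2| <= d ->
  `|pairing z - pairing w| <= d * (1 + `|w.1| + `|w.2|).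
Proof.
move=> d0 d1 h1 h2.
have -> : pairing z - pairing w = duality (z.1 - w.1) (z.2 - w.2) +
    (duality w.1 (z.2 - w.2) + duality (z.1 - w.1) w.2).
  by rewrite /pairing !dualityE; ring.
have n1 := normr_ge0 (z.1 - w.1); have n2 := normr_ge0 (z.2 - w.2).
apply: (le_trans (ler_normD _ _)); rewrite -[1 + _ + _]addrA.
rewrite [leRHS]mulrDr mulr1; apply: lerD.
  by apply: (le_trans (normr_duality _ _)); nra.
apply: (le_trans (ler_normD _ _)); rewrite [leRHS]mulrDr; apply: lerD.
  by apply: (le_trans (normr_duality _ _)); rewrite mulrC ler_wpM2r.
by apply: (le_trans (normr_duality _ _)); rewrite ler_wpM2r.
Qed.

Lemma bronsted_rockafellar H r z0 t0 e : geometrically_complete E ->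
  convex_rel H -> above_pairing H -> closed_rel H -> 0 < r ->
  energy_approximable H (r ^+ 2) -> 0 < e ->
  H z0 t0 -> t0 - pairing z0 < e ^+ 2 ->
  exists z, [/\ H z (pairing z), r * `|z.1 - z0.1| < e &
    `|z.2 - z0.2| < r * e].
Proof.
move=> Ecomp Hcvx Hq Hcl r0 Happ e0 H0 t0e.
(* [a^2] lies midway between the initial gap and [e^2]; the difference [e - a] is the room for all
   steps after the first. *)
pose a := Num.sqrt (2^-1 * (t0 - pairing z0 + e ^+ 2)).
have gap0 : 0 <= t0 - pairing z0 by rewrite subr_ge0; exact: Hq.
have e20 : 0 < e ^+ 2 by rewrite exprn_gt0.
have a2 : a ^+ 2 = 2^-1 * (t0 - pairing z0 + e ^+ 2).
  by rewrite sqr_sqrtr//; lra.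
have a0 : 0 < a by rewrite sqrtr_gt0; lra.
have ae : a < e by rewrite -(ltr_pXn2r (ltn0Sn 1)) ?nnegrE ?ltW// a2; lra.
(* With gaps at most [(a * rho^k)^2] the displacements sum to at most
   [a * (1 + 4 * rho) / (1 - rho)]. This is below [e] iff [(4 * a + e) * rho < e - a]; [rho] takes
   half of that. *)
pose rho := (e - a) / (2 * (4 * a + e)).
have rho0 : 0 < rho by rewrite divr_gt0 ?subr_gt0//; lra.
have rhoE : 2 * (4 * a + e) * rho = e - a.
  by rewrite /rho mulrC divfK// gt_eqF//; lra.
clearbody rho; have rho1 : rho < 1 by nra.
have rho01 : 0 <= rho < 1 by rewrite rho1 ltW.
pose b k := a * rho ^+ k.
have b0 k : 0 < b k by rewrite mulr_gt0// exprn_gt0.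
have step z k : exists w, exists t, H w t /\
    t - pairing w + energy (r ^+ 2) (w - z) < b k.+1 ^+ 2.
  by apply: Happ; rewrite exprn_gt0.
have /choice[F FE] : forall p : (E * dual_space E) * nat, exists w, exists t,
    H w t /\ t - pairing w + energy (r ^+ 2) (w - p.1) < b p.2.+1 ^+ 2.
  by move=> [z k]; exact: step.
pose u := fix u k := if k is k'.+1 then F (u k', k') else z0.
have uH k : exists t, H (u k) t /\ t - pairing (u k) <= b k ^+ 2.
  case: k => [|k]; first by exists t0; split => //; rewrite /b expr0 mulr1 a2; lra.
  have [t [Ht /= ht]] := FE (u k, k); exists t; split => //.
  have := energy_ge0 (r ^+ 2) (u k.+1 - u k).
  by rewrite exprn_gt0// => /(_ isT) /=; lra.
pose M := a * (1 + 4 * rho).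
have M0 : 0 <= M by rewrite mulr_ge0 ?ltW// addr_gt0// mulr_gt0.
have ustep k : r * `|(u k.+1).1 - (u k).1| <= M * rho ^+ k /\
    `|(u k.+1).2 - (u k).2| <= r * (M * rho ^+ k).
  have [t [Ht tb]] := uH k; have [t' [/= Ht' tb']] := FE (u k, k).
  have := energy_gap_step _ _ _ _ _ _ _ _ Hcvx Hq Ht Ht' (b0 k) (b0 k.+1) r0 tb tb'.
  suff -> : b k + 4 * b k.+1 = M * rho ^+ k by [].
  by rewrite /b /M exprS; ring.
have [|k|x xE] := Ecomp (fun k => (u k).1) (r^-1 * M) rho rho01.
- by rewrite mulr_ge0 ?invr_ge0 ?(ltW r0).
- by rewrite -mulrA ler_pdivlMl//; have [] := ustep k.
have [|k|g gE] := @dual_geometrically_complete _ E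
  (fun k => (u k).2) (r * M) rho rho01.
- by rewrite mulr_ge0 ?(ltW r0).
- by rewrite -mulrA; have [] := ustep k.
have Me : M / (1 - rho) < e by rewrite ltr_pdivrMr ?subr_gt0// /M; nra.
exists (x, g); split; first last.
- have := gE 0%N; rewrite expr0 mulr1 distrC /= => /le_lt_trans; apply.
  by rewrite -mulrA ltr_pM2l.
- have := xE 0%N; rewrite expr0 mulr1 distrC /= -(ler_pM2l r0) => /le_lt_trans.
  by apply; rewrite !mulrA divff ?gt_eqF// mul1r.
apply: Hcl => eps eps0.
have rho1' : 0 < 1 - rho by rewrite subr_gt0.
pose A := r^-1 * M / (1 - rho); pose B := r * M / (1 - rho).
have A0 : 0 <= A by rewrite divr_ge0 ?(ltW rho1')// mulr_ge0 ?invr_ge0 ?(ltW r0).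
have B0 : 0 <= B by rewrite divr_ge0 ?(ltW rho1')// mulr_ge0 ?(ltW r0).
pose D := A + B + 1; have D0 : 0 < D by rewrite /D; lra.
pose K := 1 + `|x| + `|g|.
have K1 : 1 <= K by rewrite /K -addrA lerDl addr_ge0.
(* The denominator adds up the error of the pairing ([D * K]), the gap ([a^2]) and the distance to
   the limit ([D]), all per unit of [rho^k]. *)
have [k kd] : exists k, rho ^+ k < Num.min (D^-1) (eps / (D * K + a ^+ 2 + D)).
  apply: exp_lt_eventually => //; rewrite lt_min invr_gt0 D0 divr_gt0//.
  by rewrite addr_gt0// addr_gt0 ?exprn_gt0// mulr_gt0//; lra.
move: kd; rewrite lt_min => /andP[]; rewrite -[D^-1]mul1r !ltr_pdivlMr//; last first.
  by rewrite addr_gt0// addr_gt0 ?exprn_gt0// mulr_gt0//; lra.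
move=> kd1 kd2; have [t [Ht tb]] := uH k.
have rk0 : 0 < rho ^+ k by rewrite exprn_gt0.
have rk1 : rho ^+ k <= 1 by rewrite exprn_ile1 ?ltW.
have h1 : `|(u k).1 - x| <= rho ^+ k * D.
  apply: (le_trans (xE k)).
  by rewrite mulrAC -/A mulrC ler_pM2l// /D; lra.
have h2 : `|(u k).2 - g| <= rho ^+ k * D.
  apply: (le_trans (gE k)).
  by rewrite mulrAC -/B mulrC ler_pM2l// /D; lra.
have Dk0 : 0 <= rho ^+ k * D by rewrite mulr_ge0// ltW.
have := pairing_dist_le (u k) (x, g) _ Dk0 (ltW kd1) h1 h2.
rewrite ler_norml => /andP[_]; rewrite -/K /= => hp.
exists (u k), t; split => //=.
- by apply: (le_lt_trans h1); nra.
- by apply: (le_lt_trans h2); nra.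
- move: tb; rewrite /b exprMn => tb.
  have : a ^+ 2 * rho ^+ k ^+ 2 <= a ^+ 2 * rho ^+ k.
    by rewrite ler_pM2l ?exprn_gt0// expr2 ler_piMl// ltW.
  by nra.
Qed.

End bronsted_rockafellar.

(** * Monotone operators *)

Section monotone.
Context {R : realType} {E : normedModType R}.
Implicit Types (T : set (E * dual_space E)) (z w p : E * dual_space E).
Implicit Types (H : E * dual_space E -> R -> Prop) (f : dual_space E).
Implicit Types (xi : dual_space (dual_space E)) (a c d e s t N : R).

Definition cross z w : R := duality z.1 w.2 + duality w.1 z.2.

Lemma pairingB z w : pairing (z - w) = pairing z - cross z w + pairing w.
Proof. by rewrite /pairing /cross /= !dualityE; ring. Qed.

Lemma cross_ge z w : - (`|z.1| * `|w.2| + `|z.2| * `|w.1|) <= cross z w.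
Proof.
have := duality_ge z.1 w.2; have := duality_ge w.1 z.2.
by rewrite /cross (mulrC `|w.1|); lra.
Qed.

(** Where [H] touches the pairing it lies above the tangent: apply convexity on the segment from [w]
    to [z], divide by the weight [s] of [z], and let [s] tend to 0. *)
Lemma touch_ge_cross H z w t : convex_rel H -> above_pairing H ->
  H z t -> H w (pairing w) -> cross z w - pairing w <= t.
Proof.
move=> Hcvx Hq Hz Hw; rewrite leNgt; apply/negP => lt.
have key s : 0 < s -> s <= 1 ->
    cross z w - pairing w - t <= - (s * pairing (z - w)).
  move=> s0 s1; have s01 : 0 <= s <= 1 by rewrite ltW.
  have := Hq _ _ (Hcvx _ _ _ _ _ s01 Hz Hw); rewrite pairing_conv.
  have := pairingB z w; set d := pairing (z - w) => dE h.
  rewrite -(ler_pM2l s0); nra.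
pose d := `|pairing (z - w)|; pose g := cross z w - pairing w - t.
have g0 : 0 < g by rewrite subr_gt0.
have d0 : 0 <= d := normr_ge0 _.
(* Small enough for [s * d < g], which contradicts [key]. *)
pose s := g / (g + 2 * d); have gd : 0 < g + 2 * d by lra.
have sE : s * (g + 2 * d) = g by rewrite divfK ?gt_eqF.
have s0 : 0 < s by rewrite divr_gt0.
have s1 : s <= 1 by rewrite ler_pdivrMr// mul1r lerDl mulr_ge0.
have := key s s0 s1; rewrite -/g; have := ler_norm (- pairing (z - w)).
by rewrite normrN -/d; clearbody s; nra.
Qed.

Lemma touch_monotone H z w : convex_rel H -> above_pairing H ->
  H z (pairing z) -> H w (pairing w) -> 0 <= pairing (z - w).
Proof.
move=> Hcvx Hq Hz Hw; have := touch_ge_cross _ _ _ _ Hcvx Hq Hz Hw.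
by rewrite pairingB; lra.
Qed.

Lemma monotone_pairing T z w : monotone_op (@duality R E) T ->
  T z -> T w -> 0 <= pairing (z - w).
Proof. by case: z w => [x f] [y g] Tm Tz Tw; exact: Tm. Qed.

Lemma maximal_monotone_related T z : maximal_monotone_op (@duality R E) T ->
  (forall w, T w -> 0 <= pairing (z - w)) -> T z.
Proof.
move=> [Tm Tmax] zT; suff <- : T `|` [set z] = T by right.
apply: Tmax; last by move=> w Tw; left.
have sym w : pairing (w - z) = pairing (z - w).
  by rewrite /pairing/= !dualityE; ring.
move=> x f y g Sx Sy; suff : 0 <= pairing ((x, f) - (y, g)) by rewrite /pairing.
move: Sx Sy => [Tx|->] [Ty|->].
- exact: monotone_pairing Tx Ty.
- by rewrite sym zT.
- exact: zT.
- by rewrite subrr /pairing duality0l.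
Qed.

Lemma maximal_monotone_nonempty T : maximal_monotone_op (@duality R E) T ->
  exists w, T w.
Proof.
move=> Tmax; apply: contrapT => nT; apply: (nT); exists 0.
by apply: maximal_monotone_related => // w Tw; exfalso; apply: nT; exists w.
Qed.

Definition fitzpatrick_rel T z t := forall w, T w -> cross z w - pairing w <= t.

Lemma fitzpatrick_rel_convex T : convex_rel (fitzpatrick_rel T).
Proof.
move=> z1 z2 t1 t2 s /andP[s0 s1] h1 h2 w Tw.
have := h1 _ Tw; have := h2 _ Tw; rewrite /cross /= !dualityE => h3 h4.
by nra.
Qed.

Lemma fitzpatrick_rel_in T z : monotone_op (@duality R E) T -> T z ->
  fitzpatrick_rel T z (pairing z).
Proof.
move=> Tm Tz w Tw; have := monotone_pairing _ _ _ Tm Tz Tw.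
by rewrite pairingB; lra.
Qed.

(** A height below [pairing z] would make [z] monotonically related to [T], hence a point of [T];
    but then [w = z] already forces height [pairing z]. *)
Lemma fitzpatrick_rel_above T : maximal_monotone_op (@duality R E) T ->
  above_pairing (fitzpatrick_rel T).
Proof.
move=> Tmax z t zt; rewrite leNgt; apply/negP => tz.
have /zt : T z.
  apply: maximal_monotone_related => // w Tw; rewrite pairingB.
  by have := zt _ Tw; lra.
rewrite /cross -/(pairing z); lra.
Qed.

Lemma touch_graph T H z : maximal_monotone_op (@duality R E) T ->
  convex_rel H -> above_pairing H -> (forall w, T w -> H w (pairing w)) ->
  H z (pairing z) -> T z.
Proof.
move=> Tmax Hcvx Hq HT Hz; apply: maximal_monotone_related => // w /HT Hw.
exact: touch_monotone Hcvx Hq Hz Hw.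
Qed.

Lemma fitzpatrick_rel_touch T z : maximal_monotone_op (@duality R E) T ->
  fitzpatrick_rel T z (pairing z) -> T z.
Proof.
move=> Tmax; apply: (touch_graph T (fitzpatrick_rel T)) => //.
- exact: fitzpatrick_rel_convex.
- exact: fitzpatrick_rel_above.
- by move=> w; apply: fitzpatrick_rel_in; case: Tmax.
Qed.

Lemma fitzpatrick_rel_closed T : closed_rel (fitzpatrick_rel T).
Proof.
move=> z t zt w Tw; apply/ler_addgt0Pr => e e0.
pose K := 1 + `|w.1| + `|w.2|.
have K0 : 0 < K by rewrite /K -addrA ltr_wpDr ?addr_ge0.
have [p [s [pT p1 p2 ps]]] := zt (e / (K + 1)) (divr_gt0 e0 (ltr_wpDr ler01 K0)).
have := pT _ Tw; have := cross_ge (p - z) w.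
have -> : cross (p - z) w = cross p w - cross z w.
  by rewrite /cross/= !dualityE; ring.
rewrite /=; set d := e / (K + 1) in p1 p2 ps *.
have dE : d * (K + 1) = e by rewrite divfK// gt_eqF// ltr_wpDr.
have : `|p.1 - z.1| * `|w.2| <= d * `|w.2| by rewrite ler_wpM2r// ltW.
have : `|p.2 - z.2| * `|w.1| <= d * `|w.1| by rewrite ler_wpM2r// ltW.
have d0 : 0 < d by rewrite divr_gt0// ltr_wpDr.
by rewrite -dE /K; lra.
Qed.

Definition real_type_NI T := forall f xi e, 0 < e ->
  exists w, T w /\ duality (w.2 - f) (bidual_embedding w.1 - xi) < e.

(** For [w = (x, r)] and [z = (z0, f)], energy at most [e] says that [f - r] is an [e]-subgradient
    of the half square at [x - z0]. This is condition 9 in terms of the energy. *)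
Definition energy_dense T := forall z e, 0 < e ->
  exists w, T w /\ energy 1 (w - z) < e.

Lemma duality_embedding f xi w :
  duality (w.2 - f) (bidual_embedding w.1 - xi) =
  pairing w - duality w.1 f - duality w.2 xi + duality f xi.
Proof.
rewrite dualityBl !dualityBr.
rewrite -[duality w.2 (bidual_embedding w.1)]/(pairing w).
by rewrite -[duality f (bidual_embedding w.1)]/(duality w.1 f); ring.
Qed.

Lemma NI_minorant T f xi a : real_type_NI T ->
  (forall w, T w -> duality w.1 f + duality w.2 xi - a <= pairing w) ->
  duality f xi <= a.
Proof.
move=> TNI Ta; apply/ler_addgt0Pr => e e0.
have [w [Tw]] := TNI f xi e e0; rewrite duality_embedding.
by have := Ta _ Tw; lra.
Qed.

Lemma NI_approximable T c : maximal_monotone_op (@duality R E) T ->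
  real_type_NI T -> 0 < c -> energy_approximable (fitzpatrick_rel T) c.
Proof.
move=> Tmax TNI c0; have [w0 Tw0] := maximal_monotone_nonempty _ Tmax.
have Tfitz w : T w -> fitzpatrick_rel T w (pairing w).
  by apply: fitzpatrick_rel_in; case: Tmax.
apply: fenchel_approx => //.
- exact: fitzpatrick_rel_convex.
- by exists w0, (pairing w0); exact: Tfitz.
- move=> f xi a fa; apply: (NI_minorant T f xi a TNI) => -[x g] Tw.
  exact: fa (Tfitz _ Tw).
Qed.

(* [xi] is nearly attained on the unit ball of the dual, so [v] is a nearly
   optimal choice in Young's inequality for [- xi]. *)
Lemma young_approx xi e : 0 < e -> exists v,
  2^-1 * (`|xi| ^+ 2 + `|v| ^+ 2) + duality v xi < e.
Proof.
move=> e0; have x1 : 0 < `|xi| + 1 by rewrite ltr_wpDl.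
have [u u1 hu] := dual_norm_approx xi _ (divr_gt0 e0 x1).
exists (- (`|xi| *: u)); rewrite dualityNl dualityZl normrN normrZ normr_id.
set a := `|xi| in x1 hu *; set d := e / (a + 1) in hu.
have dE : d * (a + 1) = e by rewrite divfK// gt_eqF.
have a0 : 0 <= a := normr_ge0 _; have d0 : 0 < d by rewrite divr_gt0.
have : (a * `|u|) ^+ 2 <= a ^+ 2 by rewrite ler_pXn2r ?nnegrE ?mulr_ge0// ler_piMr.
by clearbody d; nra.
Qed.

(** Young's inequality absorbs the two cross terms of the (NI) expression. The squares then regroup
    into the energy of [w - (0, f - v)] and the quantity of [young_approx], each below [e / 2]. *)
Lemma energy_dense_NI T : energy_dense T -> real_type_NI T.
Proof.
move=> Td f xi e e0; have e20 : 0 < e / 2 by rewrite divr_gt0.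
have [v hv] := young_approx xi _ e20.
have [w [Tw hw]] := Td (0, f - v) _ e20; exists w; split => //.
have -> : duality (w.2 - f) (bidual_embedding w.1 - xi) =
    pairing (w - (0, f - v)) - duality w.1 v - duality (w.2 - (f - v)) xi +
    duality v xi.
  rewrite duality_embedding.
  by rewrite /pairing /= subr0 !dualityE; ring.
have := duality_ge (w.2 - (f - v)) xi; have := duality_ge w.1 v.
move: hw; rewrite /energy /= subr0 invr1 !mul1r.
set n1 := `|w.1|; set n2 := `|_ - _|; set p := pairing _.
by have := sqr_ge0 (n1 - `|v|); have := sqr_ge0 (n2 - `|xi|); nra.
Qed.

Lemma energy_perturb z p d : `|p.1| <= d -> `|p.2| <= d ->
  energy 1 (z + p) <= energy 1 z + 2 * d * (`|z.1| + `|z.2|) + 2 * d ^+ 2.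
Proof.
move=> p1 p2; have d0 : 0 <= d by exact: le_trans (normr_ge0 _) p1.
rewrite /energy invr1 !mul1r.
have sqr (V : normedModType R) (u v : V) : `|v| <= d ->
    `|u + v| ^+ 2 <= (`|u| + d) ^+ 2.
  move=> vd; rewrite ler_pXn2r ?nnegrE ?addr_ge0//.
  by apply: (le_trans (ler_normD _ _)); rewrite lerD2l.
have := sqr _ z.1 p.1 p1; have := sqr _ z.2 p.2 p2.
have -> : pairing (z + p) = pairing z + cross z p + pairing p.
  by rewrite /pairing /cross/= !dualityE; ring.
rewrite /cross /pairing /=.
have := duality_le z.1 p.2; have := duality_le p.1 z.2; have := duality_le p.1 p.2.
set x1 := `|z.1|; set x2 := `|z.2|; set y1 := `|p.1|; set y2 := `|p.2|.
have x10 : 0 <= x1 := normr_ge0 _; have x20 : 0 <= x2 := normr_ge0 _.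
have y10 : 0 <= y1 := normr_ge0 _; have y20 : 0 <= y2 := normr_ge0 _.
have : x1 * y2 <= x1 * d by rewrite ler_wpM2l.
have : y1 * x2 <= d * x2 by rewrite ler_wpM2r.
have : y1 * y2 <= d * d by rewrite ler_pM.
rewrite !expr2; nra.
Qed.

(* [t - pairing w + energy 1 (w - z)] grows quadratically in [w - z], because
   [H] has the affine minorant attached to a point of [T]. *)
Lemma energy_coercive H w0 z N : convex_rel H -> above_pairing H ->
  H w0 (pairing w0) -> exists M, 0 <= M /\ forall w t, H w t ->
  t - pairing w + energy 1 (w - z) <= N * (1 + `|(w - z).1| + `|(w - z).2|) ->
  `|(w - z).1| <= M /\ `|(w - z).2| <= M.
Proof.
move=> Hcvx Hq Hw0.
(* The linear coefficients of [x2] and [x1] respectively: [cross] pairs each component with the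
   other one. Completing the squares leaves [2 * C + A^2 + B^2]. *)
pose A := N + `|(w0 - z).1|; pose B := N + `|(w0 - z).2|.
pose C := N + pairing w0 - cross z (w0 - z) - pairing z.
pose K := 1 + `|2 * C + A ^+ 2 + B ^+ 2|.
exists (`|A| + `|B| + K); split; first by rewrite !addr_ge0.
move=> w t Hw.
have := touch_ge_cross _ _ _ _ Hcvx Hq Hw Hw0.
have := cross_ge (w - z) (w0 - z).
have -> : cross (w - z) (w0 - z) = cross w w0 - cross w z - cross z (w0 - z).
  by rewrite /cross /= !dualityE; ring.
rewrite /energy pairingB invr1 !mul1r.
set x1 := `|(w - z).1|; set x2 := `|(w - z).2|.
have x10 : 0 <= x1 := normr_ge0 _; have x20 : 0 <= x2 := normr_ge0 _.
move=> h1 h2 h3.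
have : (x1 - B) ^+ 2 + (x2 - A) ^+ 2 <= 2 * C + A ^+ 2 + B ^+ 2.
  rewrite /A /B /C; nra.
have K1 : 1 <= K by rewrite /K lerDl.
have := ler_norm (2 * C + A ^+ 2 + B ^+ 2).
have -> : `|2 * C + A ^+ 2 + B ^+ 2| = K - 1 by rewrite /K; ring.
move=> h4 h5.
have h6 : (x1 - B) ^+ 2 <= K ^+ 2 by have := sqr_ge0 (x2 - A); nra.
have h7 : (x2 - A) ^+ 2 <= K ^+ 2 by have := sqr_ge0 (x1 - B); nra.
have K0 : 0 <= K by lra.
have := ler_norm A; have := ler_norm B.
have := normr_ge0 A; have := normr_ge0 B.
have sqr_le x : x ^+ 2 <= K ^+ 2 -> x <= K.
  by move=> xK; rewrite leNgt; apply/negP => Kx; nra.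
by move: h6 h7 => /sqr_le h6 /sqr_le h7; split; lra.
Qed.

(** Moving [w] into [T] by at most [d] costs energy proportional to [d * |w - z|]. Coercivity bounds
    [|w - z|] beforehand, so [d] can be fixed before [w] is known. *)
Lemma approximable_energy_dense T H : geometrically_complete E ->
  maximal_monotone_op (@duality R E) T -> convex_rel H -> above_pairing H ->
  closed_rel H -> (forall w, T w -> H w (pairing w)) ->
  energy_approximable H 1 -> energy_dense T.
Proof.
move=> Ecomp Tmax Hcvx Hq Hcl HT Happ z e e0.
have [w0 /HT Hw0] := maximal_monotone_nonempty _ Tmax.
have [M [M0 HM]] := energy_coercive _ _ z 1 Hcvx Hq Hw0.
pose d := Num.min 1 (e / (4 * M + 4)).
have M4 : 0 < 4 * M + 4 by lra.
have d0 : 0 < d by rewrite lt_min ltr01 divr_gt0.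
have d1 : d <= 1 by rewrite ge_min lexx.
have de : d * (4 * M + 4) <= e by rewrite -ler_pdivlMr// ge_min lexx orbT.
clearbody d; have d20 : 0 < d ^+ 2 by rewrite exprn_gt0.
have [w [t [Hw tw]]] := Happ z _ d20.
have gw := Hq _ _ Hw; have ew := energy_ge0 1 (w - z) ltr01.
have [] := HM _ _ Hw.
  have : d ^+ 2 <= 1 by rewrite expr_le1// ltW.
  have := normr_ge0 (w - z).1; have := normr_ge0 (w - z).2; lra.
move=> w1 w2.
have [||v [Hv v1 v2]] :=
  bronsted_rockafellar H 1 w t d Ecomp Hcvx Hq Hcl ltr01 _ d0 Hw.
- by rewrite expr1n.
- by lra.
exists v; split; first by apply: touch_graph Hv => //.
have -> : v - z = (w - z) + (v - w) by rewrite [RHS]addrC addrA subrK.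
rewrite !mul1r in v1 v2; have := energy_perturb (w - z) (v - w) d (ltW v1) (ltW v2).
by nra.
Qed.

End monotone.

(** * Surjectivity of the perturbed operators *)

Section duality_mapping.
Context {R : realType} {E : normedModType R}.
Implicit Types (T : set (E * dual_space E)) (x : E) (f : dual_space E).

(** Optimizing the subgradient inequality over [y] produces the conjugate of the half square, which
    is the half square of the dual norm. *)
Lemma eps_duality_mappingP (eps : R) x f : eps_duality_mapping E eps (x, f) <->
  2^-1 * (`|x| ^+ 2 + `|f| ^+ 2) <= duality x f + eps.
Proof.
split=> [h|h y] /=; last first.
  rewrite /half_sqr_norm -EFinD lee_fin dualityBl.
  have := duality_le y f; set a := `|y|; set b := `|f| in h *; set c := `|x| in h *.
  by have := sqr_ge0 (a - b); nra.
have : 2^-1 * `|x| ^+ 2 - duality x f - eps <= - (2^-1 * 1^-1 * `|- f| ^+ 2).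
  apply: (linear_quadratic_le 1) => // y; have := h y.
  rewrite /= /half_sqr_norm -EFinD lee_fin dualityBl dualityNr mulr1; lra.
rewrite normrN invr1 mulr1; lra.
Qed.

Lemma closure_setTP (V : normedModType R) (A : set V) : closure A = setT <->
  forall v (e : R), 0 < e -> exists w, A w /\ `|v - w| < e.
Proof.
split=> [AT v e e0|h].
  have : closure A v by rewrite AT.
  move=> /(_ _ (nbhsx_ballx v e e0))[w [Aw]].
  by rewrite -ball_normE /= => vw; exists w.
apply/seteqP; split => // v _ B /nbhs_ballP[e /= e0 eB].
have [w [Aw vw]] := h v e e0; exists w; split => //; apply: eB.
by rewrite -ball_normE.
Qed.

(** Replacing [f0] by a nearby [r + s] perturbs the energy by a multiple of [|x| + |s|], which
    density alone does not bound; coercivity does. *)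
Lemma range_dense_energy_dense T : maximal_monotone_op (@duality R E) T ->
  (forall (eps : R) (z0 : E), 0 < eps ->
    closure (op_range (op_sum (op_translate T z0) (eps_duality_mapping E eps)))
    = [set: dual_space E]) ->
  energy_dense T.
Proof.
move=> Tmax Td [x0 f0] e e0.
have [w0 Tw0] := maximal_monotone_nonempty _ Tmax.
(* With [eps] and [d] at most 1 and [|s| <= |p.2| + d], the perturbed energy is at most
   [5 + 2 * (|p.1| + |p.2|)]. *)
have [M [M0 HM]] := energy_coercive _ _ (x0, f0) 5 (fitzpatrick_rel_convex T)
  (fitzpatrick_rel_above _ Tmax) (fitzpatrick_rel_in _ _ (proj1 Tmax) Tw0).
pose d := Num.min 1 (e / (4 * (4 * M + 4))).
have M4 : 0 < 4 * (4 * M + 4) by lra.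
have d0 : 0 < d by rewrite lt_min ltr01 divr_gt0.
have d1 : d <= 1 by rewrite ge_min lexx.
have de : d * (4 * (4 * M + 4)) <= e by rewrite -ler_pdivlMr// ge_min lexx orbT.
clearbody d.
pose eps := Num.min 1 (e / 2).
have eps0 : 0 < eps by rewrite lt_min ltr01 divr_gt0.
have eps1 : eps <= 1 by rewrite ge_min lexx.
have epse : eps <= e / 2 by rewrite ge_min lexx orbT.
have /closure_setTP/(_ f0 d d0) := Td eps x0 eps0.
move=> [_ [[x [r [s [/= Txr /eps_duality_mappingP xs ->]]]] fd]].
have hE : energy 1 (x, - s) <= eps.
  by clear fd; rewrite /energy /pairing /= invr1 !mul1r normrN dualityNr; lra.
exists (x + x0, r); split => //.
pose p : E * dual_space E := (x + x0, r) - (x0, f0).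
have pE : p = (x, - s) + (0, r + s - f0).
  congr pair; first by rewrite /= addrK addr0.
  by rewrite /= [r + s]addrC -addrA addKr.
have px : p.1 = x by rewrite /= addrK.
have h0 : `|(0 : E, r + s - f0).1| <= d by rewrite /= normr0 ltW.
have h1 : `|(0 : E, r + s - f0).2| <= d by rewrite /= distrC ltW.
have := energy_perturb (x, - s) (0, r + s - f0) d h0 h1.
rewrite -pE /= normrN => hp.
have hs : `|s| <= `|p.2| + d.
  have -> : s = - p.2 + (r + s - f0).
    by rewrite /= opprB addrC addrA subrK addrAC subrr add0r.
  by rewrite (le_trans (ler_normD _ _))// normrN lerD.
have d20 : d ^+ 2 <= d by rewrite expr2 ler_piMl// ltW.
have := HM (x + x0, r) _ (fitzpatrick_rel_in _ _ (proj1 Tmax) Txr).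
rewrite subrr add0r -/p px; clear fd h0 h1 pE HM.
have := normr_ge0 x; have := normr_ge0 p.2; move: hE hs hp.
move: (energy 1 p) (energy 1 (x, - s)) (`|x|) (`|p.2|) (`|s|).
clear px p xs Txr => E1 E2 a b n hE hs hp b0 a0 HM.
have [|aM bM] := HM; first by nra.
have : d * (a + n) <= d * (2 * M + 1) by rewrite ler_pM2l//; lra.
by nra.
Qed.

Lemma energy_dense_range T : energy_dense T ->
  forall (eps : R) (z0 : E), 0 < eps ->
    op_range (op_sum (op_translate T z0) (eps_duality_mapping E eps))
    = [set: dual_space E].
Proof.
move=> Td eps z0 eps0; apply/seteqP; split => // f _.
have [[x r] [Txr]] := Td (z0, f) eps eps0.
rewrite /energy /pairing /= invr1 !mul1r => h.
exists (x - z0), r, (f - r); split => /=.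
- by rewrite /op_translate /= subrK.
- apply/eps_duality_mappingP; rewrite -(opprB r f) normrN dualityNr; lra.
- by rewrite addrCA subrr addr0.
Qed.

End duality_mapping.

(** * The sum of a monotone operator and the duality mapping *)

Section sum_with_duality_mapping.
Context {R : realType} {E : normedModType R} (T : set (E * dual_space E)).
Implicit Types (x v : E) (f g s : dual_space E) (z w : E * dual_space E).
Implicit Types (a t tau : R) (xi : dual_space (dual_space E)).

(** The convex hull of the pairing restricted to [T], as the intersection of all convex relations
    containing it. An affine minorant on [T] is such a relation and so extends to the hull. *)
Definition graph_hull z t := forall C : E * dual_space E -> R -> Prop,
  convex_rel C -> (forall w, T w -> C w (pairing w)) -> C z t.

Lemma graph_hull_convex : convex_rel graph_hull.
Proof.
move=> z1 z2 t1 t2 s s01 h1 h2 C Ccvx CT.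
by apply: (Ccvx) => //; [exact: h1|exact: h2].
Qed.

Lemma graph_hull_in w : T w -> graph_hull w (pairing w).
Proof. by move=> Tw C _; apply. Qed.

Lemma graph_hull_minorant z t f xi a : graph_hull z t ->
  (forall w, T w -> duality w.1 f + duality w.2 xi - a <= pairing w) ->
  duality z.1 f + duality z.2 xi - a <= t.
Proof.
move=> zt Ta.
apply: (zt (fun z t => duality z.1 f + duality z.2 xi - a <= t)) => //.
move=> u v r1 r2 s /andP[s0 s1] h1 h2; rewrite /= !dualityE; nra.
Qed.

(* The value at [(x, s)] of the convolution in the second variable of the
   Fitzpatrick function of [T] with [(|.|^2 + |.|^2) / 2], written by duality as
   a supremum so that it is visibly convex and lower semicontinuous. *)
Definition sum_rel (p : E * dual_space E) t := forall v g tau,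
  graph_hull (v, g) tau ->
  2^-1 * `|p.1| ^+ 2 - t <=
  tau - duality p.1 g + 2^-1 * `|v| ^+ 2 - duality v p.2.

Lemma sum_rel_convex : convex_rel sum_rel.
Proof.
move=> p q t1 t2 s s01 h1 h2 v g tau hv.
have := h1 _ _ _ hv; have := h2 _ _ _ hv.
have := sqr_norm_convex p.1 q.1 s s01.
have /andP[s0 s1] := s01; rewrite /= !dualityE.
set n := `|_| ^+ 2; set n1 := `|_| ^+ 2; set n2 := `|_| ^+ 2; set n3 := `|_| ^+ 2.
by nra.
Qed.

Lemma sum_rel_closed : closed_rel sum_rel.
Proof.
move=> z t zt v g tau hv; apply/ler_addgt0Pr => e e0.
pose K := 1 + `|z.1| + `|g| + `|v|.
have K0 : 0 < K by rewrite /K -!addrA ltr_wpDr// !addr_ge0.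
pose d := e / K; have d0 : 0 < d by rewrite divr_gt0.
have dK : d * K = e by rewrite divfK ?gt_eqF.
have [p [s [ps p1 p2 sd]]] := zt d d0.
have := ps _ _ _ hv.
have := duality_le (z.1 - p.1) g; have := duality_le v (z.2 - p.2).
have : `|z.1 - p.1| * `|g| <= d * `|g| by rewrite ler_wpM2r// distrC ltW.
have : `|v| * `|z.2 - p.2| <= `|v| * d by rewrite ler_wpM2l// distrC ltW.
have n0 : `|z.1| <= `|p.1| + d.
  rewrite -(subrK p.1 z.1) addrC (le_trans (ler_normD _ _))// lerD2l distrC.
  exact: ltW.
have : 2^-1 * `|z.1| ^+ 2 - d * `|z.1| <= 2^-1 * `|p.1| ^+ 2.
  have h0 := normr_ge0 z.1; have h1 := normr_ge0 p.1.
  by have [h2|h2] := leP d `|z.1|; nra.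
rewrite !dualityE -dK /K; lra.
Qed.

Lemma sum_rel_in x f g a t : fitzpatrick_rel T (x, f) a ->
  a + 2^-1 * (`|x| ^+ 2 + `|g| ^+ 2) <= t -> sum_rel (x, f + g) t.
Proof.
move=> xa at_le v h tau hv.
have : duality v f + duality x h - a <= tau.
  apply: (graph_hull_minorant _ _ _ (bidual_embedding x) _ hv) => w Tw.
  rewrite -[duality w.2 _]/(duality x w.2).
  by have := xa _ Tw; rewrite /cross /=; lra.
have := duality_le v g; rewrite /= !dualityE.
set n1 := `|v|; set n2 := `|g| in at_le *.
by have := sqr_ge0 (n1 - n2); nra.
Qed.

(** The supremum is turned back into an attained convolution: the convolved variable lives in the
    dual, and the sandwich in [v] produces it as its functional [f]. *)
Lemma sum_rel_split x s t : (exists w, T w) -> sum_rel (x, s) t -> exists f a,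
  fitzpatrick_rel T (x, f) a /\
  a + 2^-1 * (`|x| ^+ 2 + `|s - f| ^+ 2) <= t.
Proof.
move=> [w0 Tw0] xst.
have [|||||f [a [fa af]]] := sandwich
  (fun v r => exists g tau, graph_hull (v, g) tau /\ r = tau - duality x g)
  (fun v => 2^-1 * `|v| ^+ 2 - duality v s - 2^-1 * `|x| ^+ 2 + t)
  (2^-1 + `|s| - 2^-1 * `|x| ^+ 2 + t).
- move=> u v r1 r2 l l01 [g [tau [h1 ->]]] [g' [tau' [h2 ->]]].
  exists (l *: g + (1 - l) *: g'), (l * tau + (1 - l) * tau').
  split; first exact: (graph_hull_convex _ _ _ _ _ l01 h1 h2).
  by rewrite !dualityE; ring.
- exists w0.1, (pairing w0 - duality x w0.2), w0.2, (pairing w0).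
  by split => //; case: w0 Tw0 => u g; exact: graph_hull_in.
- move=> u v l l01; have := sqr_norm_convex u v l l01; rewrite !dualityE; lra.
- move=> v v1; have := duality_ge v s; have : `|v| * `|s| <= `|s|.
    by rewrite ler_piMl.
  have : `|v| ^+ 2 <= 1 by rewrite expr_le1.
  by lra.
- by move=> v _ [g [tau [/xst /= h ->]]]; lra.
exists f, a; split.
  move=> [y g] Tw; rewrite /cross /=.
  suff : duality y f - a <= pairing (y, g) - duality x g by lra.
  by apply: fa; exists g, (pairing (y, g)); split => //; exact: graph_hull_in.
have : a + 2^-1 * `|x| ^+ 2 - t <= - (2^-1 * 1^-1 * `|f - s| ^+ 2).
  apply: linear_quadratic_le => // v; have := af v; rewrite !dualityE; lra.
by rewrite invr1 mulr1 distrC; lra.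
Qed.

Hypothesis Tmax : maximal_monotone_op (@duality R E) T.

Lemma sum_rel_above : above_pairing sum_rel.
Proof.
move=> [x s] t /(sum_rel_split _ _ _ (maximal_monotone_nonempty _ Tmax)).
move=> [f [a [/(fitzpatrick_rel_above _ Tmax) xf at_le]]].
move: xf; rewrite /pairing /=; have := duality_le x (s - f); rewrite !dualityE.
set n1 := `|x| in at_le *; set n2 := `|s - f| in at_le *.
by have := sqr_ge0 (n1 - n2); nra.
Qed.

(** A minorant [(f, xi)] of the sum is split into [(L, xi)], a minorant on [T] to which (NI)
    applies, and [f - L], paid for by the half squares. *)
Lemma sum_rel_approximable c : real_type_NI T -> 0 < c ->
  energy_approximable sum_rel c.
Proof.
move=> TNI c0; have [w0 Tw0] := maximal_monotone_nonempty _ Tmax.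
have TH := fitzpatrick_rel_in _ _ (proj1 Tmax).
apply: fenchel_approx => //; first exact: sum_rel_convex.
  exists (w0.1, w0.2 + 0),
    (pairing w0 + 2^-1 * (`|w0.1| ^+ 2 + `|0 : dual_space E| ^+ 2)).
  apply: (sum_rel_in _ _ _ (pairing w0)) => //; case: w0 Tw0 => ? ?; exact: TH.
move=> f xi a sa.
(* The summand [h] ranges over the whole dual; minimizing over it leaves [- |xi|^2 / 2]. *)
have fitza x g t : fitzpatrick_rel T (x, g) t ->
    duality x f + duality g xi - a - t - 2^-1 * `|x| ^+ 2 <=
    - (2^-1 * 1^-1 * `|- xi| ^+ 2).
  move=> xgt; apply: linear_quadratic_le => // h.
  have := sa _ _ _ (sum_rel_in _ _ h _ _ xgt (lexx _)).
  by rewrite !dualityE; lra.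
have [|||||L [b [Lb bL]]] := sandwich
  (fun x r => exists g t, fitzpatrick_rel T (x, g) t /\ r = t - duality g xi)
  (fun x => 2^-1 * `|x| ^+ 2 - duality x f - 2^-1 * `|xi| ^+ 2 + a)
  (2^-1 + `|f| - 2^-1 * `|xi| ^+ 2 + a).
- move=> u v r1 r2 l l01 [g [tau [h1 ->]]] [g' [tau' [h2 ->]]].
  exists (l *: g + (1 - l) *: g'), (l * tau + (1 - l) * tau').
  split; first exact: (fitzpatrick_rel_convex T _ _ _ _ _ l01 h1 h2).
  by rewrite !dualityE; ring.
- exists w0.1, (pairing w0 - duality w0.2 xi), w0.2, (pairing w0).
  by split => //; case: w0 Tw0 => u g; exact: TH.
- move=> u v l l01; have := sqr_norm_convex u v l l01; rewrite !dualityE; lra.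
- move=> v v1; have := duality_ge v f; have : `|v| * `|f| <= `|f|.
    by rewrite ler_piMl.
  have : `|v| ^+ 2 <= 1 by rewrite expr_le1.
  by lra.
- by move=> v _ [g [tau [/fitza + ->]]]; rewrite normrN invr1 mulr1; lra.
have Lxi : duality L xi <= b.
  apply: (NI_minorant T) => // -[x g] Tw /=.
  suff : duality x L - b <= pairing (x, g) - duality g xi by lra.
  by apply: Lb; exists g, (pairing (x, g)); split => //; exact: TH.
have : b + 2^-1 * `|xi| ^+ 2 - a <= - (2^-1 * 1^-1 * `|L - f| ^+ 2).
  apply: linear_quadratic_le => // v; have := bL v; rewrite !dualityE; lra.
have := duality_ge (L - f) xi; rewrite dualityBl invr1 mulr1.
set n1 := `|L - f|; set n2 := `|xi|.
by have := sqr_ge0 (n1 - n2); nra.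
Qed.

(** Energy below [e^2] at [(0, s)] is a gap below [e^2] for [sum_rel] at [(x, s)], so a contact
    point of [sum_rel] lies within [e]. *)
Lemma range_sum_dense : geometrically_complete E -> real_type_NI T ->
  energy_dense T -> forall s e, 0 < e -> exists x f g,
  [/\ T (x, f), duality_mapping E (x, g) & `|s - (f + g)| < e].
Proof.
move=> Ecomp TNI Td s e e0.
have e20 : 0 < e ^+ 2 by rewrite exprn_gt0.
have [[x f] [Txf]] := Td (0, s) _ e20.
rewrite /energy /pairing /= subr0 invr1 !mul1r => hE.
have Hxf := fitzpatrick_rel_in _ _ (proj1 Tmax) Txf.
have hs := sum_rel_in _ _ (s - f) _ _ Hxf (lexx _).
rewrite addrC subrK in hs.
have [||[y s'] [hy _ /= y2]] := bronsted_rockafellar sum_rel 1 _ _ e Ecomp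
  sum_rel_convex sum_rel_above sum_rel_closed ltr01 _ e0 hs.
- by rewrite expr1n; exact: sum_rel_approximable.
- by move: hE; rewrite /pairing /= (distrC s) dualityBr; lra.
(* At a contact point the two inequalities of the sum, for [T] and for the duality mapping, must
   both be equalities. *)
have [h [a [ha hya]]] := sum_rel_split _ _ _ (maximal_monotone_nonempty _ Tmax) hy.
rewrite /pairing /= in hya.
have ya := fitzpatrick_rel_above _ Tmax _ _ ha; rewrite /pairing/= in ya.
exists y, h, (s' - h); split.
- apply: fitzpatrick_rel_touch => //.
  move=> w Tw; apply: le_trans (ha w Tw) _.
  have := duality_le y (s' - h); rewrite /pairing /= dualityBr.
  set n1 := `|y| in hya *; set n2 := `|s' - h| in hya *.
  by clear y2; have := sqr_ge0 (n1 - n2); nra.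
- by clear y2; apply/(eps_duality_mappingP 0); rewrite dualityBr; lra.
- by rewrite [h + _]addrC subrK distrC -(mul1r e).
Qed.

End sum_with_duality_mapping.

(** * Gossez's monotone closure *)

Section gossez_approximation.
Context {R : realType} {X : normedModType R}.
Local Notation Xd := (dual_space X).
Local Notation Xdd := (dual_space Xd).
Implicit Types (T : set (X * Xd)) (z w : X * Xd) (C : X * Xd -> R -> Prop).
Implicit Types (f g u : Xd) (xi eta : Xdd) (a d e s t K : R).

(** The epigraph of the conjugate of [S_function T] when [T] is maximal monotone
    ([S_function_conjugate]); it lies above the pairing exactly when (NI) holds. *)
Definition conjugate_rel T (p : Xd * Xdd) a := forall w, T w ->
  duality w.1 p.1 + duality w.2 p.2 - a <= pairing w.

Lemma conjugate_rel_convex T : convex_rel (conjugate_rel T).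
Proof.
move=> p q r1 r2 s /andP[s0 s1] h1 h2 w Tw.
by have := h1 _ Tw; have := h2 _ Tw; rewrite /= !dualityE; nra.
Qed.

Lemma conjugate_rel_above T : real_type_NI T -> above_pairing (conjugate_rel T).
Proof. by move=> TNI [f xi] a; exact: NI_minorant. Qed.

(** The monotone closure becomes a set of contact points, so under (NI) the lemmas on contact apply
    to it between the dual and the bidual. *)
Lemma gossez_closureP T xi f : gossez_closure T (xi, f) <->
  conjugate_rel T (f, xi) (duality f xi).
Proof.
split=> [h [y g] Tyg|h y g Tyg] /=.
  have := h _ _ Tyg; rewrite /bidual_duality /= !dualityE.
  rewrite -[duality f (bidual_embedding y)]/(duality y f).
  by rewrite -[duality g (bidual_embedding y)]/(pairing (y, g)); lra.
have := h _ Tyg; rewrite /bidual_duality /= !dualityE.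
rewrite -[duality f (bidual_embedding y)]/(duality y f).
by rewrite -[duality g (bidual_embedding y)]/(pairing (y, g)); lra.
Qed.

Lemma gossez_minorant T xi f u eta a : real_type_NI T ->
  gossez_closure T (xi, f) -> conjugate_rel T (u, eta) a ->
  duality u xi + duality f eta - duality f xi <= a.
Proof.
move=> TNI /gossez_closureP fxi ua.
exact: touch_ge_cross (conjugate_rel_convex T) (conjugate_rel_above _ TNI) ua fxi.
Qed.

Lemma gossez_closure_monotone T : real_type_NI T ->
  monotone_op (@bidual_duality R X) (gossez_closure T).
Proof.
move=> TNI xi f eta g /gossez_closureP h1 /gossez_closureP h2.
have := touch_monotone _ _ _ (conjugate_rel_convex T)
  (conjugate_rel_above _ TNI) h1 h2.
by rewrite /pairing /bidual_duality /=.
Qed.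

(** Exact penalties for finitely many linear constraints are exchanged for Lagrange multipliers,
    whose combination is [u]. *)
Lemma weak_star_multiplier (gs : seq Xd) xi K : 0 <= K ->
  forall C, convex_rel C -> (exists v t, C v t) ->
  (forall v t, C v t ->
     0 <= t + K * \sum_(g <- gs) `|duality v.1 g - duality g xi|) ->
  exists u, forall v t, C v t -> 0 <= t + duality v.1 u - duality u xi.
Proof.
move=> K0; elim: gs => [|g gs IH] C Ccvx [v0 [t0 C0]] Cgs.
  exists 0 => v t /Cgs; rewrite big_nil mulr0 addr0.
  by rewrite duality0l subr0.
(* The penalty of [g] is hidden in the heights, so that the induction hypothesis removes the
   others. *)
pose C' v t' := exists t, C v t /\ t + K * `|duality v.1 g - duality g xi| <= t'.
have [|||u Cu] := IH C'.
- move=> v1 v2 t1 t2 s s01 [r1 [h1 l1]] [r2 [h2 l2]].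
  exists (s * r1 + (1 - s) * r2); split; first exact: Ccvx.
  have /andP[s0 s1] := s01; rewrite /= !dualityE.
  set x := duality _ _ in l1 *; set y := duality _ _ in l2 *; set c := duality _ _.
  have -> : s * x + (1 - s) * y - c = s * (x - c) + (1 - s) * (y - c) by ring.
  have : `|s * (x - c) + (1 - s) * (y - c)| <= s * `|x - c| + (1 - s) * `|y - c|.
    rewrite (le_trans (ler_normD _ _))// !normrM (ger0_norm s0).
    by rewrite (@ger0_norm _ (1 - s)) ?subr_ge0.
  by move=> /(ler_wpM2l K0); nra.
- by exists v0, (t0 + K * `|duality v0.1 g - duality g xi|), t0.
- move=> v t [r [/Cgs]]; rewrite big_cons mulrDr; lra.
(* A sandwich on the line of values of the remaining constraint: its slope [L 1] is the multiplier
   of [g]. *)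
have [||||L [b [lL Lb bL]]] := @linear_sandwich R R^o
  (fun r t' => exists v t, [/\ C v t, r = duality v.1 g - duality g xi &
     t' = t + duality v.1 u - duality u xi]) (fun r => K * `|r|).
- move=> r1 r2 t1 t2 s s01 [v1 [l1 [h1 -> ->]]] [v2 [l2 [h2 -> ->]]].
  exists (s *: v1 + (1 - s) *: v2), (s * l1 + (1 - s) * l2).
  split; first exact: Ccvx.
    by rewrite /GRing.scale/= !dualityE; ring.
  by rewrite /= !dualityE; ring.
- exists (duality v0.1 g - duality g xi), (t0 + duality v0.1 u - duality u xi).
  by exists v0, t0.
- move=> r1 r2 s /andP[s0 s1]; rewrite !(mulrCA _ K) -mulrDr ler_wpM2l//.
  rewrite (le_trans (ler_normD _ _))// !normrZ (ger0_norm s0).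
  by rewrite (@ger0_norm _ (1 - s)) ?subr_ge0.
- move=> _ _ [v [t [Cvt -> ->]]].
  have := Cu v (t + K * `|duality v.1 g - duality g xi|).
  move=> /(_ (ex_intro _ t (conj Cvt (lexx _)))); lra.
have LZ r : L r = r * L 1.
  have L0 : L 0 = 0 by have := lL (-1) 0 0; rewrite scaler0 addr0 scaleN1r addNr.
  by have := lL r 1 0; rewrite L0 !addr0 /GRing.scale/= mulr1.
exists (u - L 1 *: g) => v t Cvt; rewrite !dualityE.
have := bL 0; rewrite normr0 mulr0 LZ mul0r subr0 => b0.
have := Lb _ _ (ex_intro _ v (ex_intro _ t (And3 Cvt erefl erefl))).
rewrite LZ; lra.
Qed.

Definition gossez_penalty xi f d z := d * `|z.1| ^+ 2 + d^-1 * `|z.2 - f| ^+ 2 -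
  (duality f xi + d * (`|xi| ^+ 2 + 1)).

Lemma gossez_penalty_convex xi f d : 0 < d -> convex_fun (gossez_penalty xi f d).
Proof.
move=> d0; have dV0 : 0 <= d^-1 by rewrite invr_ge0 ltW.
have h1 : convex_fun (fun v : X => `|v| ^+ 2) by exact: sqr_norm_convex.
have {}h1 := convex_funZ _ _ (ltW d0) (convex_fun_fst (F := Xd) _ h1).
have h2 := convex_funZ _ _ dV0 (convex_fun_snd (E := X) _ (sqr_dist_convex f)).
exact: convex_funD _ _ (convex_funD _ _ h1 h2) (convex_fun_cst _).
Qed.

(** Otherwise the sum is replaced by a multiplier [u], and separation gives an affine minorant
    [(v, eta)] on [T]. [gossez_minorant] evaluates it at [(xi, f)] as if that were a point of the
    hull, against a separation with margin [d]. *)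
Lemma gossez_hull_approx T xi f (gs : seq Xd) d : (exists w, T w) ->
  real_type_NI T -> gossez_closure T (xi, f) -> 0 < d ->
  exists z t, graph_hull T z t /\
    t - duality f xi + d * `|z.1| ^+ 2 + d^-1 * `|z.2 - f| ^+ 2 +
    2 * \sum_(g <- gs) `|duality z.1 g - duality g xi| < d * (`|xi| ^+ 2 + 1).
Proof.
move=> [w0 Tw0] TNI gxi d0; apply: contrapT => nz.
have [k kE] : exists k, k = gossez_penalty xi f d by exists (gossez_penalty xi f d).
have kcvx : convex_fun k by rewrite kE; exact: gossez_penalty_convex.
have [|||u Cu] := weak_star_multiplier gs xi 2 (ler0n _ 2)
  (fun z r => exists t, graph_hull T z t /\ t + k z <= r).
- move=> v1 v2 t1 t2 s s01 [r1 [h1 l1]] [r2 [h2 l2]].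
  exists (s * r1 + (1 - s) * r2); split; first exact: graph_hull_convex.
  have /andP[s0 s1] := s01; rewrite -subr_ge0 in s1.
  apply: (le_trans _ (lerD (ler_wpM2l s0 l1) (ler_wpM2l s1 l2))).
  rewrite [s * (_ + _)]mulrDr [(1 - s) * (_ + _)]mulrDr [leRHS]addrACA lerD2l.
  exact: kcvx.
- exists w0, (pairing w0 + k w0), (pairing w0); split => //.
  exact: graph_hull_in.
- move=> z r [t [zt tr]]; rewrite leNgt; apply/negP => lt0; apply: nz.
  by exists z, t; split => //; move: tr; rewrite kE /gossez_penalty; lra.
have [|||||L [a [La aL]]] := sandwich (graph_hull T)
    (fun z => k z + duality z.1 u - duality u xi)
    (d + d^-1 * (1 + `|f|) ^+ 2 - duality f xi - d * (`|xi| ^+ 2 + 1) + `|u| -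
     duality u xi).
- exact: graph_hull_convex.
- by exists w0, (pairing w0); exact: graph_hull_in.
- by move=> v1 v2 s s01; have := kcvx v1 v2 s s01; rewrite /= !dualityE; lra.
- move=> [x g]; rewrite prod_normE ge_max/= => /andP[x1 g1].
  rewrite kE /gossez_penalty /=.
  have : d * `|x| ^+ 2 <= d by rewrite ler_piMr ?(ltW d0)// expr_le1.
  have : d^-1 * `|g - f| ^+ 2 <= d^-1 * (1 + `|f|) ^+ 2.
    rewrite ler_pM2l ?invr_gt0// ler_pXn2r ?nnegrE ?addr_ge0//.
    by rewrite (le_trans (ler_normB _ _))// lerD2r.
  have := duality_le x u; have : `|x| * `|u| <= `|u| by rewrite ler_piMl.
  by lra.
- move=> z t zt; have := Cu z (t + k z); rewrite addrA => /(_ _).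
  by rewrite -!addrA; apply; exists t.
have [v [eta LE]] := dual_prod L.
have := gossez_minorant T xi f v eta a TNI gxi.
have Ta : conjugate_rel T (v, eta) a.
  by move=> [y g] Tw /=; have := La _ _ (graph_hull_in _ _ Tw); rewrite LE.
move=> /(_ Ta); apply/negP; rewrite -ltNge.
(* Since [xi] is not a point of [X], the ball of radius [|xi|] in [X] is used in its place. *)
have : a - duality f eta + duality f xi + d * (`|xi| ^+ 2 + 1) + duality u xi <=
    2^-1 * (2 * d) * `|xi| ^+ 2 - `|xi| * `|v + u|.
  apply: linear_quadratic_bound => //; first by rewrite mulr_gt0.
  move=> x; have := aL (x, f); rewrite LE kE /gossez_penalty /=.
  rewrite subrr normr0 expr0n mulr0.
  by rewrite !dualityE; lra.
have := duality_ge (v + u) xi; rewrite dualityDl (mulrC `|v + u|).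
by lra.
Qed.

End gossez_approximation.

(** * Type (D) *)

Section gossez_nets.
Context {R : realType}.

Lemma cvg_weak_star {E : normedModType R} {I : Type} (F : set_system I)
    {FF : Filter F} (u : I -> dual_space E) (l : dual_space E) :
  (forall x, duality x (u i) @[i --> F] --> duality x l) ->
  (u i : weak_star E) @[i --> F] --> (l : weak_star E).
Proof.
move=> ul A [_ [[B Bo <-] Bl] sBA].
pose v i : {ptws E -> R^o} := dual_fun (u i).
have vl : {ptws, v @ F --> (dual_fun l : E -> R^o)}.
  by apply/pointwise_cvgP => x; exact: ul.
have /vl : nbhs (dual_fun l : {ptws E -> R^o}) B by rewrite nbhsE; exists B.
by move=> FB; apply: (@filterS _ F FF (v @^-1` B)) => // i Bi; exact: sBA.
Qed.

Context {X : normedModType R}.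
Local Notation Xd := (dual_space X).
Local Notation Xdd := (dual_space Xd).
Implicit Types (T : set (X * Xd)) (f g : Xd) (xi : Xdd) (e : R).

Lemma le_sum_mem (I : eqType) (s : seq I) (F : I -> R) i :
  (forall j, 0 <= F j) -> i \in s -> F i <= \sum_(j <- s) F j.
Proof.
move=> F0 /perm_to_rem si; rewrite (perm_big _ si) /= big_cons lerDl.
exact: (@sumr_ge0 R I (rem i s) xpredT F (fun j _ => F0 j)).
Qed.

(** [M] is fixed before [gs] and [e]; this is what makes the net bounded. *)
Lemma gossez_approx T xi f : geometrically_complete X ->
  maximal_monotone_op (@duality R X) T -> real_type_NI T ->
  gossez_closure T (xi, f) -> exists M : R, forall (gs : seq Xd) e, 0 < e ->
  exists w, [/\ T w, `|w.1| <= M, `|w.2 - f| < e &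
    forall g, g \in gs -> `|duality w.1 g - duality g xi| < e].
Proof.
move=> Xcomp Tmax TNI gxi; pose N := `|xi| ^+ 2 + 1.
have N1 : 1 <= N by rewrite lerDr sqr_ge0.
have N0 : 0 < N by lra.
exists (2 * N + 1) => gs e e0.
pose G := \sum_(g <- gs) `|g|.
have G0 : 0 <= G by exact: sumr_ge0.
have G4 : 0 < 4 + G by lra.
pose e1 := Num.min 1 (e / (4 + G)).
have e10 : 0 < e1 by rewrite lt_min ltr01 divr_gt0.
have e11 : e1 <= 1 by rewrite ge_min lexx.
have e1e : e1 * (4 + G) <= e by rewrite -ler_pdivlMr// ge_min lexx orbT.
clearbody e1; pose d := e1 ^+ 2 / N.
have d0 : 0 < d by rewrite divr_gt0// exprn_gt0.
have dN : d * N = e1 ^+ 2 by rewrite divfK// gt_eqF.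
(* [f] joins the list so that [pairing z] can be compared with [duality f xi]. *)
have [z [t [zt]]] := gossez_hull_approx T xi f (f :: gs) d
  (maximal_monotone_nonempty _ Tmax) TNI gxi d0.
rewrite -/N dN; set S := \sum_(g <- _) _ => hz.
have S0 : 0 <= S by exact: sumr_ge0.
have Sg g : g \in f :: gs -> `|duality z.1 g - duality g xi| <= S.
  by move=> /le_sum_mem; exact.
have zt' : fitzpatrick_rel T z t.
  apply: zt; first exact: fitzpatrick_rel_convex.
  by move=> w; apply: fitzpatrick_rel_in; case: Tmax.
have zq := fitzpatrick_rel_above _ Tmax _ _ zt'.
have zf : duality f xi - S - `|z.1| * `|z.2 - f| <= pairing z.
  have := duality_ge z.1 (z.2 - f); have := Sg f (mem_head _ _).
  rewrite ler_norml /pairing !dualityE => /andP[] *; lra.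
(* Half of the penalties, including one of the two copies of [S], pays for this comparison; the
   other half bounds [S] and the norms. *)
have hxy : `|z.1| * `|z.2 - f| <=
    2^-1 * (d * `|z.1| ^+ 2 + d^-1 * `|z.2 - f| ^+ 2).
  rewrite -subr_ge0.
  have -> : 2^-1 * (d * `|z.1| ^+ 2 + d^-1 * `|z.2 - f| ^+ 2) - `|z.1| * `|z.2 - f|
    = 2^-1 * d * (`|z.1| - d^-1 * `|z.2 - f|) ^+ 2 by field; rewrite gt_eqF.
  by rewrite mulr_ge0 ?sqr_ge0// mulr_ge0// ltW.
pose y := d^-1 * `|z.2 - f|.
have y0 : 0 <= y by rewrite mulr_ge0 ?invr_ge0 ?(ltW d0) ?normr_ge0.
have yE : `|z.2 - f| = d * y by rewrite mulrA divff ?mul1r// gt_eqF.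
have dy : d^-1 * `|z.2 - f| ^+ 2 = d * y ^+ 2.
  by rewrite yE; field; rewrite gt_eqF.
rewrite dy in hz hxy; clearbody y.
have x0 := normr_ge0 z.1.
have e20 : 0 < e1 ^+ 2 by rewrite exprn_gt0.
have SN : S < e1 ^+ 2 by nra.
have xN : `|z.1| < 2 * N.
  have : d * `|z.1| ^+ 2 < d * (2 * N) by nra.
  by rewrite ltr_pM2l// => ?; nra.
have yN : y < 2 * N.
  have : d * y ^+ 2 < d * (2 * N) by nra.
  by rewrite ltr_pM2l// => ?; nra.
have fN : `|z.2 - f| < 2 * e1 ^+ 2.
  by rewrite yE -dN mulrCA ltr_pM2l.
have [||v [Hv v1 v2]] := bronsted_rockafellar (fitzpatrick_rel T) 1 z t e1 Xcomp
  (fitzpatrick_rel_convex T) (fitzpatrick_rel_above _ Tmax)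
  (fitzpatrick_rel_closed T) ltr01 _ e10 zt'.
- by rewrite expr1n; exact: NI_approximable.
- by nra.
rewrite !mul1r in v1 v2.
have ee : e1 ^+ 2 <= e1 by rewrite expr2 ler_piMl// ltW.
exists v; split.
- exact: fitzpatrick_rel_touch.
- rewrite -(subrK z.1 v.1) (le_trans (ler_normD _ _))//; lra.
- rewrite -(subrK z.2 v.2) -addrA (le_lt_trans (ler_normD _ _))//; nra.
- move=> g ggs; have gG : `|g| <= G by apply: (le_sum_mem _ gs (fun g => `|g|)).
  have := Sg g; rewrite in_cons ggs orbT => /(_ isT) gS.
  have -> : duality v.1 g - duality g xi =
      duality (v.1 - z.1) g + (duality z.1 g - duality g xi).
    by rewrite !dualityE; ring.
  rewrite (le_lt_trans (ler_normD _ _))//.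
  have := normr_duality (v.1 - z.1) g.
  have : `|v.1 - z.1| * `|g| <= e1 * G by rewrite ler_pM// ltW.
  by lra.
Qed.

Lemma NI_gossez_type_D T : geometrically_complete X ->
  maximal_monotone_op (@duality R X) T -> real_type_NI T -> gossez_type_D T.
Proof.
move=> Xcomp Tmax TNI [xi f] gxi.
have [M HM] := gossez_approx _ _ _ Xcomp Tmax TNI gxi.
(* An index is a finite list of functionals to be tested and a precision; concatenation and maximum
   make the order directed. *)
pose le (i j : seq Xd * nat) := {subset i.1 <= j.1} /\ (i.2 <= j.2)%N.
have /choice[u uE] : forall i : seq Xd * nat, exists w,
    [/\ T w, `|w.1| <= M, `|w.2 - f| < i.2.+1%:R^-1 &
    forall g, g \in i.1 -> `|duality w.1 g - duality g xi| < i.2.+1%:R^-1].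
  by move=> i; apply: HM; rewrite invr_gt0.
have ledir : directed_preorder le.
  split; first by exists ([::], 0%N).
  - by move=> i; split.
  - by move=> j i k [h1 h2] [h3 h4]; split; [move=> x /h1/h3|exact: leq_trans h4].
  - move=> i j; exists (i.1 ++ j.1, maxn i.2 j.2); split; split => /=.
    + by move=> x; rewrite mem_cat => ->.
    + exact: leq_maxl.
    + by move=> x; rewrite mem_cat orbC => ->.
    + exact: leq_maxr.
have [_ lerefl letrans ledir2] := ledir.
have FF : Filter (net_tails le).
  apply: filter_from_filter; first by exists ([::], 0%N).
  move=> i j _ _; have [k [ik jk]] := ledir2 i j.
  by exists k => // l kl; split; apply: letrans kl.
exists (seq Xd * nat)%type, le, u; split => //.
- by move=> i; have [] := uE i.
- exists (M + `|f| + 1); split; first exact: num_real.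
  move=> K MK i _ /=; rewrite prod_normE ge_max.
  have [_ u1 u2 _] := uE i; apply/andP; split.
    by apply: (le_trans u1); rewrite (le_trans _ (ltW MK))// -addrA lerDl addr_ge0.
  apply: le_trans (ltW MK); rewrite -(subrK f (u i).2) (le_trans (ler_normD _ _))//.
  have M0 : 0 <= M by exact: le_trans (normr_ge0 _) u1.
  have : `|(u i).2 - f| <= 1.
    by rewrite (le_trans (ltW u2))// invf_le1// ler1n.
  by lra.
- have small (e : R) : 0 < e -> exists n, forall k, (n <= k)%N -> k.+1%:R^-1 < e.
    move=> e0; have [n _ hn] := near_infty_natSinv_lt (PosNum e0).
    by exists n => k nk; exact: hn.
  apply: (@cvg_pair _ (weak_star Xd) Xd _ (nbhs (xi : weak_star Xd)) (nbhs f) FF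
    _ _ (fun i => bidual_embedding (u i).1) (fun i => (u i).2)).
  + apply: cvg_weak_star => g; apply/cvgrPdist_lt => e e0.
    have [n hn] := small e e0; exists ([:: g], n) => //= i [/= gi ni].
    have [_ _ _ /(_ g)] := uE i; rewrite gi ?mem_head// => /(_ isT) h.
    rewrite distrC; exact: lt_trans h (hn _ ni).
  + apply/cvgrPdist_lt => e e0.
    have [n hn] := small e e0; exists ([::], n) => //= i [/= gi ni].
    have [_ _ + _] := uE i => h.
    rewrite distrC; exact: lt_trans h (hn _ ni).
Qed.

(** Outside the closure some point of [T] gives a negative value. On the closure, the product along
    the net is a bounded factor times one that tends to 0 in norm. *)
Lemma gossez_type_D_NI T : gossez_type_D T -> real_type_NI T.
Proof.
move=> TD f xi e e0.
have [gxi|] := pselect (gossez_closure T (xi, f)); last first.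
  move=> /existsNP[y /existsNP[g /not_implyP[Tyg /negP]]].
  rewrite -ltNge /bidual_duality /= => h.
  exists (y, g); split => //=; apply: lt_trans e0.
  move: h; rewrite -(opprB f) -(opprB xi) dualityNl dualityNr opprK.
  by [].
have [I [le [u [[[i0 _] lerefl letrans ledir] uT [M [_ ub]] ucvg]]]] := TD _ gxi.
pose K := `|M| + 1 + `|xi|.
have K0 : 0 < K by rewrite /K addrAC ltr_wpDl// addr_ge0.
have uM i : `|(u i).1| <= `|M| + 1.
  have : `|u i| <= `|M| + 1 by apply: ub => //; rewrite ltr_pwDr// ler_norm.
  by rewrite prod_normE ge_max => /andP[].
have FF : Filter (net_tails le).
  apply: filter_from_filter; first by exists i0.
  move=> i j _ _; have [k [ik jk]] := ledir i j.
  by exists k => // l kl; split; apply: letrans kl.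
have u2 : (u i).2 @[i --> net_tails le] --> f.
  exact: (cvg_comp _ _ ucvg cvg_snd).
have /cvgrPdist_lt/(_ _ (divr_gt0 e0 K0))[i _ /(_ i (lerefl i)) hi] := u2.
exists (u i); split => //.
apply: le_lt_trans (duality_le _ _) _.
rewrite distrC; apply: (@le_lt_trans _ _ (`|f - (u i).2| * K)).
  rewrite ler_wpM2l// (le_trans (ler_normB _ _))// lerD2r.
  apply: dual_norm_le; first exact: addr_ge0.
  move=> g; apply: (le_trans (normr_duality (u i).1 g)); exact: ler_wpM2r.
by rewrite -ltr_pdivlMr.
Qed.

End gossez_nets.

(** * Extended-real-valued functions *)

Section extended_real.
Context {R : realType}.
Local Open Scope ereal_scope.
Implicit Types (x y : \bar R) (S : set (\bar R)).

Lemma ereal_sup_le_fin S (a : R) : ereal_sup S <= a%:E <-> ubound S a%:E.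
Proof.
split=> [Sa x Sx|]; last exact: ge_ereal_sup.
exact: le_trans (ereal_sup_ubound Sx) Sa.
Qed.

Lemma ereal_inf_le_fin S (a : R) : ereal_inf S <= a%:E <->
  forall e : R, (0 < e)%R -> exists2 x, S x & x < (a + e)%:E.
Proof.
split=> [Sa e e0|h].
  by apply: ereal_inf_lt; apply: le_lt_trans Sa _; rewrite lte_fin ltrDl.
apply/lee_addgt0Pr => e e0; have [x Sx /ltW xa] := h e e0.
by apply: ge_ereal_inf; exists x.
Qed.

Lemma eq_ereal_le_fin x y :
  (forall a : R, x <= a%:E <-> y <= a%:E) -> x = y.
Proof.
have le (u v : \bar R) : (forall a : R, v <= a%:E -> u <= a%:E) -> u <= v.
  case: v => [r||] uv; [exact: uv|by rewrite leey|].
  case: u uv => [r||] uv //.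
  - by have := uv (r - 1)%R (leNye _); rewrite lee_fin lerBrDr gerDl ler10.
  - by have := uv 0%R (leNye _).
by move=> xy; apply/eqP; rewrite eq_le !le// => a /xy.
Qed.

Lemma lt_ereal_fin_between (a : R) x : a%:E < x ->
  exists2 b : R, (a < b)%R & b%:E < x.
Proof.
case: x => [r||] //.
  by rewrite lte_fin => ar; exists ((a + r) / 2)%R; rewrite ?lte_fin; lra.
by move=> _; exists (a + 1)%R; rewrite ?ltry//; lra.
Qed.

End extended_real.

Section epigraph.
Context {R : realType} {E : normedModType R}.
Implicit Types (T : set (E * dual_space E)) (h : E * dual_space E -> \bar R).
Implicit Types (z p w : E * dual_space E).

Definition epigraph {V : Type} (k : V -> \bar R) (v : V) (t : R) : Prop :=
  (k v <= t%:E)%E.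

Lemma convex_epigraph {V : lmodType R} (k : V -> \bar R) :
  convex_efunction k <-> convex_rel (epigraph k).
Proof.
split=> [kc u v t r s /andP[s0 s1] ut vr|kc [u t] [v r] l /set_mem ut /set_mem vr].
  have := kc (u, t) (v, r) (Itv01 s0 s1) (mem_set ut) (mem_set vr).
  by move=> /set_mem.
apply/mem_set; apply: (kc u v t r l%:num) => //.
by rewrite ge0 le1.
Qed.

Lemma closed_epigraph h :
  lower_semicontinuous h <-> closed_rel (epigraph h).
Proof.
split=> [hl z t zt|hc z a az].
  rewrite /epigraph leNgt; apply/negP => /lt_ereal_fin_between[b tb bz].
  have [V /nbhs_ballP[e /= e0 eV] Vb] := hl _ _ bz.
  pose d := Num.min e (b - t).
  have d0 : 0 < d by rewrite lt_min e0 subr_gt0.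
  have [w [s [ws w1 w2 st]]] := zt d d0.
  have /eV/Vb : ball z e w.
    rewrite -ball_normE /= distrC prod_normE gt_max.
    by rewrite (lt_le_trans w1) ?ge_min ?lexx// (lt_le_trans w2) ?ge_min ?lexx.
  rewrite ltNge => /negP; apply; apply: le_trans ws _; rewrite lee_fin.
  have : d <= b - t by rewrite ge_min lexx orbT.
  by lra.
apply: contrapT => nV; move: az; rewrite ltNge => /negP; apply.
apply: hc => e e0; apply: contrapT => nw; apply: nV.
exists (ball z e); first exact: nbhsx_ballx.
move=> w; rewrite -ball_normE /= distrC prod_normE gt_max => /andP[w1 w2].
rewrite ltNge; apply/negP => wa; apply: nw; exists w, a; split => //; lra.
Qed.

Lemma above_epigraph h :
  (forall x f, ((duality x f)%:E <= h (x, f))%E) <-> above_pairing (epigraph h).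
Proof.
split=> [hq [x f] t xt|hq x f].
  by have := le_trans (hq x f) xt; rewrite lee_fin.
case xf : (h (x, f)) => [r||]; [|by rewrite leey|].
  by rewrite lee_fin; apply: (hq (x, f) r); rewrite /epigraph xf.
have := hq (x, f) (duality x f - 1); rewrite /epigraph xf => /(_ (leNye _)).
by rewrite /pairing /= lerBrDr gerDl ler10.
Qed.

Lemma fitzpatrick_familyP T h : fitzpatrick_family T h <->
  [/\ convex_rel (epigraph h), closed_rel (epigraph h),
      above_pairing (epigraph h) & forall w, T w -> epigraph h w (pairing w)].
Proof.
split=> [[/convex_epigraph hc /closed_epigraph hl hq hT]|].
  split => //; first exact/above_epigraph.
  by move=> [x f] Txf; rewrite /epigraph hT.
move=> [/convex_epigraph hc /closed_epigraph hl /above_epigraph hq hT].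
split=> // x f Txf; apply/eqP; rewrite eq_le hq andbT; exact: hT Txf.
Qed.

Lemma epigraph_fitzpatrick T z a :
  epigraph (fitzpatrick_function T) z a <-> fitzpatrick_rel T z a.
Proof.
rewrite /epigraph ereal_sup_le_fin; split=> [h w Tw|h _ [w Tw <-]].
  have := h _ (ex_intro2 _ _ w Tw erefl).
  by rewrite lee_fin /cross /pairing (addrC (duality z.1 _)).
by have := h _ Tw; rewrite lee_fin /cross /pairing (addrC (duality z.1 _)).
Qed.

Lemma fitzpatrick_function_family T : maximal_monotone_op (@duality R E) T ->
  fitzpatrick_family T (fitzpatrick_function T).
Proof.
move=> Tmax; apply/fitzpatrick_familyP.
have -> : epigraph (fitzpatrick_function T) = fitzpatrick_rel T.
  apply/funext => z; apply/funext => t; apply/propext.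
  exact: epigraph_fitzpatrick.
split; [exact: fitzpatrick_rel_convex|exact: fitzpatrick_rel_closed
  |exact: fitzpatrick_rel_above|].
by move=> w; apply: fitzpatrick_rel_in; case: Tmax.
Qed.

Lemma epigraph_conjugate h (p : dual_space E * dual_space (dual_space E)) a :
  epigraph (fenchel_conjugate h) p a <->
  forall z t, epigraph h z t -> duality z.1 p.1 + duality z.2 p.2 - a <= t.
Proof.
rewrite /epigraph ereal_sup_le_fin; split=> [ub z t|ha _ [z _ <-]].
  have := ub _ (ex_intro2 _ _ z I erefl).
  case: (h z) => [r||] //=.
  by rewrite -EFinB !lee_fin; lra.
have := ha z; case: (h z) => [r||] /= hr.
- by have := hr r (lexx _); rewrite -EFinB lee_fin; lra.
- by rewrite leNye.
- set c := _ + _ in hr *; have := hr (c - 1) (leNye _).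
  by rewrite lerBrDr gerDl ler10.
Qed.

Lemma fenchel_conjugate_convex h : convex_rel (epigraph (fenchel_conjugate h)).
Proof.
move=> p q a b s /andP[s0 s1] /epigraph_conjugate hp /epigraph_conjugate hq.
apply/epigraph_conjugate => z t zt; have := hp z t zt; have := hq z t zt.
by rewrite /= !dualityE; nra.
Qed.

Lemma fenchel_conjugate_closed h : closed_rel (epigraph (fenchel_conjugate h)).
Proof.
move=> p a pa; apply/epigraph_conjugate => z t zt.
apply/ler_addgt0Pr => e e0; pose K := 1 + `|z.1| + `|z.2|.
have K0 : 0 < K by rewrite /K -addrA ltr_wpDr ?addr_ge0.
pose d := e / K; have d0 : 0 < d by rewrite divr_gt0.
have dK : d * K = e by rewrite divfK ?gt_eqF.
have [q [s [/epigraph_conjugate/(_ z t zt) qs q1 q2 st]]] := pa d d0.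
have := duality_le z.1 (p.1 - q.1); have := duality_le z.2 (p.2 - q.2).
have : `|z.1| * `|p.1 - q.1| <= `|z.1| * d by rewrite ler_wpM2l// distrC ltW.
have : `|z.2| * `|p.2 - q.2| <= `|z.2| * d by rewrite ler_wpM2l// distrC ltW.
by rewrite !dualityE -dK /K; lra.
Qed.

End epigraph.

(** * The family of Fitzpatrick functions *)

Section conditions.
Context {R : realType} {X : normedModType R}.
Local Notation Xd := (dual_space X).
Local Notation Xdd := (dual_space Xd).
Implicit Types (T : set (X * Xd)) (h : X * Xd -> \bar R) (z w : X * Xd).
Implicit Types (f : Xd) (xi : Xdd).

Lemma type_NIP T : type_NI T <-> real_type_NI T.
Proof.
split=> [TNI f xi e e0|TNI f xi].
  have [_ [w Tw <-]] := (ereal_inf_le_fin _ _).1 (TNI f xi) e e0.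
  rewrite add0r lte_fin => h; exists w; split => //.
apply/ereal_inf_le_fin => e e0; have [w [Tw h]] := TNI f xi e e0.
exists (bidual_duality (bidual_embedding w.1 - xi) (w.2 - f))%:E.
  by exists w.
by rewrite add0r lte_fin.
Qed.

Lemma above_conjugate_NI T : above_pairing (conjugate_rel T) -> real_type_NI T.
Proof.
move=> Tq f xi e e0; apply: contrapT => nw.
have : conjugate_rel T (f, xi) (duality f xi - e).
  move=> w Tw /=; rewrite leNgt; apply/negP => lt0; apply: nw.
  by exists w; split => //; rewrite duality_embedding; lra.
by move=> /Tq; rewrite /pairing /=; lra.
Qed.

Lemma above_conjugateP h :
  (forall f xi, ((duality f xi)%:E <= fenchel_conjugate h (f, xi))%E) <->
  above_pairing (epigraph (fenchel_conjugate h)).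
Proof. exact: above_epigraph. Qed.

Lemma conjugate_minorant T h p a : fitzpatrick_family T h ->
  epigraph (fenchel_conjugate h) p a -> conjugate_rel T p a.
Proof.
move=> /fitzpatrick_familyP[_ _ _ hT] /epigraph_conjugate hp w Tw.
exact: hp (hT _ Tw).
Qed.

Lemma NI_above_conjugate T h : fitzpatrick_family T h -> real_type_NI T ->
  above_pairing (epigraph (fenchel_conjugate h)).
Proof.
move=> hF TNI p a /(conjugate_minorant _ _ _ _ hF).
exact: conjugate_rel_above.
Qed.

(* The maximum of the Fitzpatrick function and an affine minorant of the pairing
   on [T] belongs to the family, so [S_T] dominates all such minorants. *)
Lemma S_function_minorant T p a z : maximal_monotone_op (@duality R X) T ->
  conjugate_rel T p a ->
  ((duality z.1 p.1 + duality z.2 p.2 - a)%:E <= S_function T z)%E.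
Proof.
move=> Tmax pa.
pose l z : \bar R := (duality z.1 p.1 + duality z.2 p.2 - a)%:E.
pose h z := Order.max (fitzpatrick_function T z) (l z).
suff hF : fitzpatrick_family T h.
  apply: (@le_trans _ _ (h z)); first by rewrite le_max lexx orbT.
  by apply: ereal_sup_ubound; exists h.
have hE w t : epigraph h w t <-> fitzpatrick_rel T w t /\
    duality w.1 p.1 + duality w.2 p.2 - a <= t.
  rewrite -epigraph_fitzpatrick /epigraph /h ge_max lee_fin.
  by split=> [/andP[]|[-> ->]].
have TH := fitzpatrick_rel_in _ _ (proj1 Tmax).
apply/fitzpatrick_familyP; split.
- move=> u v r t s s01 /hE[u1 u2] /hE[v1 v2]; apply/hE; split.
    exact: fitzpatrick_rel_convex.
  by have /andP[s0 s1] := s01; rewrite /= !dualityE; nra.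
- move=> u t ut; apply/hE; split.
    apply: fitzpatrick_rel_closed => e /ut[w [s [/hE[ws _] w1 w2 st]]].
    by exists w, s.
  apply/ler_addgt0Pr => e e0; pose K := 1 + `|p.1| + `|p.2|.
  have K0 : 0 < K by rewrite /K -addrA ltr_wpDr ?addr_ge0.
  pose d := e / K; have d0 : 0 < d by rewrite divr_gt0.
  have dK : d * K = e by rewrite divfK ?gt_eqF.
  have [q [s [/hE[_ qs] q1 q2 st]]] := ut d d0.
  have := duality_le (u.1 - q.1) p.1; have := duality_le (u.2 - q.2) p.2.
  have : `|u.1 - q.1| * `|p.1| <= d * `|p.1| by rewrite ler_wpM2r// distrC ltW.
  have : `|u.2 - q.2| * `|p.2| <= d * `|p.2| by rewrite ler_wpM2r// distrC ltW.
  by rewrite !dualityE -dK /K; lra.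
- by move=> w t /hE[/(fitzpatrick_rel_above _ Tmax)].
- by move=> w Tw; apply/hE; split; [exact: TH|exact: pa].
Qed.

Lemma S_function_in T w : T w -> epigraph (S_function T) w (pairing w).
Proof.
move=> Tw; apply/ereal_sup_le_fin => _ [h /fitzpatrick_familyP[_ _ _ hT] <-].
exact: hT.
Qed.

(** [S_function T] is at most the pairing on [T] and dominates every affine minorant of it there, so
    both have the same affine minorants. *)
Lemma S_function_conjugate T p a : maximal_monotone_op (@duality R X) T ->
  epigraph (fenchel_conjugate (S_function T)) p a <-> conjugate_rel T p a.
Proof.
move=> Tmax; split=> [/epigraph_conjugate pS w Tw|pa].
  exact: pS (S_function_in _ _ Tw).
apply/epigraph_conjugate => z t zt; rewrite -lee_fin.
exact: le_trans (S_function_minorant _ _ _ _ Tmax pa) zt.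
Qed.

(** With [w = p + z] the bilinear correction and the half squares combine into
    [energy 1 p - pairing w]. The expression is therefore nonnegative, and only smallness is at
    stake. *)
Lemma shifted_infimumP T h : fitzpatrick_family T h ->
  (forall z, ereal_inf [set shifted_function h z p + half_sqr_norm p.1
                     + half_sqr_norm p.2 | p in [set: X * Xd]]%E = 0%E) <->
  energy_approximable (epigraph h) 1.
Proof.
move=> /fitzpatrick_familyP[_ _ hq _].
have val z p (r : R) : h (p + z) = r%:E ->
    (shifted_function h z p + half_sqr_norm p.1 + half_sqr_norm p.2)%E =
    (r - pairing (p + z) + energy 1 p)%:E.
  move=> pz; rewrite /shifted_function -[(p.1 + z.1, p.2 + z.2)]/(p + z) pz.
  rewrite /half_sqr_norm -EFinB -!EFinD; congr EFin.
  rewrite /energy /pairing /= invr1 !dualityE; ring.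
have valy z p : h (p + z) = +oo%E ->
    (shifted_function h z p + half_sqr_norm p.1 + half_sqr_norm p.2)%E = +oo%E.
  by move=> pz; rewrite /shifted_function -[(p.1 + z.1, p.2 + z.2)]/(p + z) pz.
have hNy w : h w <> -oo%E.
  move=> wE; have := hq w (pairing w - 1); rewrite /epigraph wE.
  by move=> /(_ (leNye _)); rewrite lerBrDr gerDl ler10.
split=> [h0 z e e0|happ z].
  have /ereal_inf_le_fin/(_ e e0)[_ [p _ <-]] : (ereal_inf [set (shifted_function
     h z p + half_sqr_norm p.1 + half_sqr_norm p.2)%E | p in [set: X * Xd]] <= 0%:E)%E.
    by rewrite h0.
  case pz : (h (p + z)) => [r||]; last by have := hNy _ pz.
    rewrite (val _ _ _ pz) add0r lte_fin => lte.
    by exists (p + z), r; split; [rewrite /epigraph pz|rewrite addrK].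
  by rewrite (valy _ _ pz).
apply/eqP; rewrite eq_le; apply/andP; split.
  apply/ereal_inf_le_fin => e e0; have [w [t [wt lte]]] := happ z e e0.
  pose p := w - z; have pz : p + z = w by rewrite subrK.
  exists (shifted_function h z p + half_sqr_norm p.1 + half_sqr_norm p.2)%E.
    by exists p.
  case wz : (h w) => [r||]; last by have := hNy _ wz.
    rewrite (val _ _ r) pz// add0r lte_fin; apply: le_lt_trans lte.
    by rewrite lerD2r lerD2r -lee_fin -wz.
  by move: wt; rewrite /epigraph wz.
apply: le_ereal_inf_tmp => _ [p _ <-].
case pz : (h (p + z)) => [r||]; last by have := hNy _ pz.
  rewrite (val _ _ _ pz) lee_fin addr_ge0 ?energy_ge0// subr_ge0.
  by apply: hq; rewrite /epigraph pz.
by rewrite (valy _ _ pz) leey.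
Qed.

Lemma above_conjugate_approximable T h :
  maximal_monotone_op (@duality R X) T -> fitzpatrick_family T h ->
  above_pairing (epigraph (fenchel_conjugate h)) ->
  energy_approximable (epigraph h) 1.
Proof.
move=> Tmax /fitzpatrick_familyP[hc _ _ hT] hq.
apply: fenchel_approx => //.
  have [w Tw] := maximal_monotone_nonempty _ Tmax.
  by exists w, (pairing w); exact: hT.
move=> f xi a ha; apply: (hq (f, xi)); apply/epigraph_conjugate => -[x g] t.
exact: ha.
Qed.

Lemma op_translate_maximal T (z0 : X) : maximal_monotone_op (@duality R X) T ->
  maximal_monotone_op (@duality R X) (op_translate T z0).
Proof.
move=> [Tm Tmax]; split=> [x f y g Tx Ty|S Sm TS].
  by have := Tm _ _ _ _ Tx Ty; rewrite /= opprD addrACA subrr addr0.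
have SE : op_translate S (- z0) = T.
  apply: Tmax => [x f y g Sx Sy|[x f] Tx].
    by have := Sm _ _ _ _ Sx Sy; rewrite /= opprD addrACA subrr addr0.
  by apply: TS; rewrite /op_translate /= subrK.
by apply/seteqP; split => -[x f]; rewrite -SE /op_translate /= addrK.
Qed.

Lemma op_translate_NI T (z0 : X) : real_type_NI T ->
  real_type_NI (op_translate T z0).
Proof.
move=> TNI f xi e e0.
have [[y g] [Tyg h]] := TNI f (xi + bidual_embedding z0) e e0.
exists (y - z0, g); split; first by rewrite /op_translate /= subrK.
move: h; rewrite (duality_embedding f xi (y - z0, g)) duality_embedding /pairing /=.
rewrite !dualityE -[duality g (bidual_embedding z0)]/(duality z0 g).
by rewrite -[duality f (bidual_embedding z0)]/(duality z0 f); lra.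
Qed.

End conditions.

(** * The equivalence and its consequences *)

Section consequences.
Context {R : realType} {X : normedModType R} (T : set (X * dual_space X)).
Hypothesis Xcomp : geometrically_complete X.
Hypothesis Tmax : maximal_monotone_op (@duality R X) T.
Hypothesis TNI : real_type_NI T.
Local Notation Xd := (dual_space X).
Local Notation Xdd := (dual_space Xd).

Lemma NI_energy_dense : energy_dense T.
Proof.
apply: (approximable_energy_dense T (fitzpatrick_rel T)) => //.
- exact: fitzpatrick_rel_convex.
- exact: fitzpatrick_rel_above.
- exact: fitzpatrick_rel_closed.
- by move=> w; apply: fitzpatrick_rel_in; case: Tmax.
- exact: NI_approximable.
Qed.

Lemma NI_strict_bronsted_rockafellar : strict_bronsted_rockafellar T.
Proof.
move=> eps x f eps0 epsT lambda lambda0.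
have [r epsr rT] := lt_ereal_fin_between _ _ epsT.
have xf : fitzpatrick_rel T (x, f) (pairing (x, f) - r).
  move=> w Tw; have := pairingB (x, f) w.
  have : (r%:E <= (pairing ((x, f) - w))%:E)%E.
    apply: le_trans (ltW rT) _; apply: ereal_inf_lbound; exists w => //.
  by rewrite lee_fin; lra.
(* With scale [r = e / lambda] the two error bounds become [e / r = lambda] and
   [e * r = eps / lambda]. *)
pose e := Num.sqrt eps; have e0 : 0 < e by rewrite sqrtr_gt0.
have e2 : e ^+ 2 = eps by rewrite sqr_sqrtr// ltW.
have el0 : 0 < e / lambda by rewrite divr_gt0.
have [||[y g] [yg yx gf]] := bronsted_rockafellar (fitzpatrick_rel T) (e / lambda)
  _ _ e Xcomp (fitzpatrick_rel_convex T) (fitzpatrick_rel_above _ Tmax)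
  (fitzpatrick_rel_closed T) el0 _ e0 xf.
- by apply: NI_approximable => //; rewrite exprn_gt0.
- by rewrite e2; lra.
exists y, g; split.
- exact: fitzpatrick_rel_touch.
- rewrite distrC; move: yx; rewrite /= -mulrA gtr_pMr// mulrC.
  by rewrite ltr_pdivrMr// mul1r.
- by rewrite distrC -e2 expr2 mulrAC.
Qed.

Lemma gossez_closure_embedding x f :
  T (x, f) -> gossez_closure T (bidual_embedding x, f).
Proof.
move=> Txf y g Tyg; have := proj1 Tmax _ _ _ _ Txf Tyg.
by rewrite dualityBl.
Qed.

(** Every monotone extension lies in the monotone closure by definition, and (NI) makes the closure
    itself monotone, hence the largest one. *)
Lemma gossez_closure_unique_extension :
  maximal_monotone_extension T (gossez_closure T) /\
  forall S, maximal_monotone_extension T S -> S = gossez_closure T.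
Proof.
have sub (S : set (Xdd * Xd)) : monotone_op (@bidual_duality R X) S ->
    (forall x f, T (x, f) -> S (bidual_embedding x, f)) -> S `<=` gossez_closure T.
  by move=> Sm TS [xi f] Sp y g /TS Sy; exact: Sm.
have Gm := gossez_closure_monotone _ TNI.
split=> [|S [[Sm Smax] TS]]; last by apply/esym/Smax => //; exact: sub.
split; last exact: gossez_closure_embedding.
split=> // S Sm GS; apply/seteqP; split => //; apply: sub => // x f Txf.
by apply: GS; exact: gossez_closure_embedding.
Qed.

Lemma S_function_conjugate_gossez : fenchel_conjugate (S_function T) =
  fitzpatrick_function (op_swap (gossez_closure T)).
Proof.
apply/funext => -[u eta]; apply: eq_ereal_le_fin => a.
rewrite -/(epigraph (fenchel_conjugate _) _ _).
rewrite -/(epigraph (fitzpatrick_function _) _ _).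
split=> [/(S_function_conjugate _ _ _ Tmax) ua|/epigraph_fitzpatrick ua].
  by apply/epigraph_fitzpatrick => -[f xi] /= fxi; exact: gossez_minorant fxi ua.
apply/(S_function_conjugate _ _ _ Tmax) => -[y g] Tyg /=.
have := ua (g, bidual_embedding y) (gossez_closure_embedding _ _ Tyg).
rewrite /cross /pairing /= -[duality u (bidual_embedding y)]/(duality y u).
by rewrite -[duality g (bidual_embedding y)]/(duality y g); lra.
Qed.

(** Contact on the closure is a limit of [touch_ge_cross] at points [w] of [T] near [(xi, f)]. For a
    given [z], testing [z.2] and [f] is enough. *)
Lemma fenchel_conjugate_gossez h : fitzpatrick_family T h ->
  fitzpatrick_family (op_swap (gossez_closure T)) (fenchel_conjugate h).
Proof.
move=> hF; apply/fitzpatrick_familyP; split.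
- exact: fenchel_conjugate_convex.
- exact: fenchel_conjugate_closed.
- exact: NI_above_conjugate hF TNI.
move=> [f xi] gxi; apply/epigraph_conjugate => z t zt.
have [M HM] := gossez_approx _ _ _ Xcomp Tmax TNI gxi.
have /fitzpatrick_familyP[hc _ hq hT] := hF.
rewrite /pairing /=; apply/ler_addgt0Pr => e e0.
pose K := 3 + `|z.1| + `|M|.
have K0 : 0 < K by rewrite /K -addrA ltr_wpDr ?addr_ge0.
pose d := e / K; have d0 : 0 < d by rewrite divr_gt0.
have dK : d * K = e by rewrite divfK ?gt_eqF.
have [w [Tw w1 w2 wg]] := HM [:: z.2; f] d d0.
have := touch_ge_cross _ _ _ _ hc hq zt (hT _ Tw).
have := wg z.2; rewrite mem_head => /(_ isT); rewrite ltr_norml => /andP[h1 h2].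
have := wg f; rewrite in_cons mem_head orbT => /(_ isT).
rewrite ltr_norml => /andP[h3 h4].
have := duality_le z.1 (f - w.2); have := duality_le w.1 (w.2 - f).
have : `|z.1| * `|f - w.2| <= `|z.1| * d by rewrite ler_wpM2l// distrC ltW.
have : `|w.1| * `|w.2 - f| <= `|M| * d.
  by apply: ler_pM => //; [exact: le_trans w1 (ler_norm M)|exact: ltW].
by rewrite /cross /pairing !dualityE -dK /K; lra.
Qed.

Lemma NI_range_closure (z0 : X) :
  closure (op_range (op_sum (op_translate T z0) (duality_mapping X)))
  = [set: Xd].
Proof.
have Tmax' := op_translate_maximal _ z0 Tmax.
have TNI' := op_translate_NI _ z0 TNI.
apply/closure_setTP => f e e0.
have Td' : energy_dense (op_translate T z0).
  move=> z d d0; have [w [Tw h]] := NI_energy_dense (z.1 + z0, z.2) d d0.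
  exists (w.1 - z0, w.2); split.
    by rewrite /op_translate /= subrK; case: w Tw {h}.
  suff -> : (w.1 - z0, w.2) - z = w - (z.1 + z0, z.2) by [].
  by congr pair; rewrite /= opprD addrA addrAC.
have [x [g [s [Tx Js h]]]] := range_sum_dense _ Tmax' Xcomp TNI' Td' f e e0.
by exists (g + s); split => //; exists x, g, s.
Qed.

End consequences.

Theorem theorem4p4 (R : realType) (X : completeNormedModType R)
    (T : set (X * dual_space X)) (hT : maximal_monotone_op (@duality R X) T) :
  let c1 := type_NI T in
  let c2 := forall (f : dual_space X) (xi : dual_space (dual_space X)),
    ((duality f xi)%:E <= fenchel_conjugate (S_function T) (f, xi))%E in
  let c3 := forall h, fitzpatrick_family T h ->
    forall (f : dual_space X) (xi : dual_space (dual_space X)),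
    ((duality f xi)%:E <= fenchel_conjugate h (f, xi))%E in
  let c4 := exists h, fitzpatrick_family T h /\
    forall (f : dual_space X) (xi : dual_space (dual_space X)),
    ((duality f xi)%:E <= fenchel_conjugate h (f, xi))%E in
  let c5 := exists h, fitzpatrick_family T h /\
    forall z : X * dual_space X,
    ereal_inf [set shifted_function h z p + half_sqr_norm p.1
                     + half_sqr_norm p.2 | p in [set: X * dual_space X]]%E
    = 0%E in
  let c6 := forall h, fitzpatrick_family T h ->
    forall z : X * dual_space X,
    ereal_inf [set shifted_function h z p + half_sqr_norm p.1
                     + half_sqr_norm p.2 | p in [set: X * dual_space X]]%E
    = 0%E in
  let c7 := forall z0 : X,
    closure (op_range (op_sum (op_translate T z0) (duality_mapping X)))
    = [set: dual_space X] in
  let c8 := forall (eps : R) (z0 : X), 0 < eps ->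
    closure (op_range (op_sum (op_translate T z0) (eps_duality_mapping X eps)))
    = [set: dual_space X] in
  let c9 := forall (eps : R) (z0 : X), 0 < eps ->
    op_range (op_sum (op_translate T z0) (eps_duality_mapping X eps))
    = [set: dual_space X] in
  let Tg := gossez_closure T in
  [<-> c1; c2; c3; c4; c5; c6; c7; c8; c9; gossez_type_D T] /\
  (c1 \/ c2 \/ c3 \/ c4 \/ c5 \/ c6 \/ c7 \/ c8 \/ c9 ->
    [/\ strict_bronsted_rockafellar T,
        maximal_monotone_extension T Tg /\
        (forall S, maximal_monotone_extension T S -> S = Tg),
        fenchel_conjugate (S_function T) = fitzpatrick_function (op_swap Tg) &
        forall h, fitzpatrick_family T h ->
          fitzpatrick_family (op_swap Tg) (fenchel_conjugate h)]).
Proof.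
move=> c1 c2 c3 c4 c5 c6 c7 c8 c9 Tg.
have Xcomp : geometrically_complete X.
  exact: complete_geometrically_complete.
have phiF := fitzpatrick_function_family _ hT.
have dense_NI : energy_dense T -> c1.
  by move=> /energy_dense_NI/type_NIP.
have eqv : [<-> c1; c2; c3; c4; c5; c6; c7; c8; c9; gossez_type_D T].
  tfae.
  - move=> /type_NIP TNI; apply/above_conjugateP => p a.
    by move=> /(S_function_conjugate _ _ _ hT); exact: conjugate_rel_above.
  - move=> /above_conjugateP c2T h hF; apply/above_conjugateP.
    apply: (NI_above_conjugate T) => //; apply: above_conjugate_NI => p a pa.
    by apply: c2T; apply/(S_function_conjugate _ _ _ hT).
  - by move=> c3T; exists (fitzpatrick_function T); split => //; exact: c3T.
  - move=> [h [hF /above_conjugateP hq]]; exists h; split => //.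
    by apply/(shifted_infimumP _ _ hF); exact: (above_conjugate_approximable T).
  (* The function [h] is exchanged for [k] through [energy_dense T] and (NI), where neither
     occurs. *)
  - move=> [h [hF /(shifted_infimumP _ _ hF) happ]] k kF.
    have /fitzpatrick_familyP[hc hl hq hh] := hF.
    apply/(shifted_infimumP _ _ kF).
    apply: (above_conjugate_approximable T) => //.
    apply: (NI_above_conjugate T) => //; apply: energy_dense_NI.
    exact: approximable_energy_dense happ.
  - move=> /(_ _ phiF)/(shifted_infimumP _ _ phiF) happ z0.
    apply: NI_range_closure => //; apply: energy_dense_NI.
    have /fitzpatrick_familyP[hc hl hq hh] := phiF.
    exact: approximable_energy_dense happ.
  - move=> c7T eps z0 eps0; apply/closure_setTP => f e e0.
    have /closure_setTP/(_ f e e0)[s [[x [g [k [Tx Jx sE]]]] h]] := c7T z0.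
    exists s; split => //; exists x, g, k; split => //.
    apply/eps_duality_mappingP; move/(eps_duality_mappingP 0): Jx; lra.
  - move=> c8T eps z0 eps0; apply: energy_dense_range => //.
    exact: range_dense_energy_dense.
  - move=> c9T; apply: NI_gossez_type_D => //; apply: energy_dense_NI.
    apply: range_dense_energy_dense => // eps z0 eps0; rewrite c9T//.
    by rewrite closureT.
  - by move=> /gossez_type_D_NI/type_NIP.
split=> // cs.
have /type_NIP TNI : c1.
  case: cs => [|cs]; first by [].
  case: cs => [|cs]; first by move/(eqv 1%N 0%N).
  case: cs => [|cs]; first by move/(eqv 2%N 0%N).
  case: cs => [|cs]; first by move/(eqv 3%N 0%N).
  case: cs => [|cs]; first by move/(eqv 4%N 0%N).
  case: cs => [|cs]; first by move/(eqv 5%N 0%N).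
  case: cs => [|cs]; first by move/(eqv 6%N 0%N).
  by case: cs; [move/(eqv 7%N 0%N)|move/(eqv 8%N 0%N)].
split.
- exact: NI_strict_bronsted_rockafellar.
- exact: gossez_closure_unique_extension.
- exact: S_function_conjugate_gossez.
- by move=> h; exact: fenchel_conjugate_gossez.
Qed.
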